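(* Let $C$ be a cosimplicial chain complex. Then there is a weak equivalence $$\operatorname{holim}_{n\in\Delta} C^n \simeq \mathrm{tot}\, C,$$ where the homotopy limit is computed in the category of chain complexes equipped with the projective model structure, and $\mathrm{tot}\,C$ denotes the total complex of $C$.
   Context: ''Chain complex'' means non-negatively graded chain complex of real vector spaces. In the projective model structure on chain complexes, weak equivalences are quasi-isomorphisms, fibrations are the maps that are surjective in degrees $\ge1$, and cofibrations are the degreewise monomorphisms. For a cosimplicial chain complex $C$, $C^p$ is the chain complex in cosimplicial degree $p$ and $C^p_q$ its degree $q$ part. The total complex is formed as follows: apply the dual Dold–Kan correspondence in the cosimplicial direction, i.e. replace $C^p_q$ by $C^{p,q}=\bigcap_i\ker(s^i:C^p_q\to C^{p-1}_q)$ (intersection over the codegeneracies), with operators $d:C^{p,q}\to C^{p,q-1}$ (the chain complex differential) and $\delta=\sum_i(-1)^id^i:C^{p,q}\to C^{p+1,q}$ (alternating sum of all the coface maps). Let $(\mathrm{tot}^{\mathbb{Z}}C)_k=\prod_{q-p=k}C^{p,q}$ for $k\in\mathbb{Z}$, with differential $D=d-(-1)^{q-p}\delta$. Then $\mathrm{tot}\,C=\tau_{\ge0}\mathrm{tot}^{\mathbb{Z}}C$, where the smart truncation $\tau_{\ge0}$ keeps the terms of degree $>0$ and replaces the degree $0$ term by the $0$-cycles, discarding negative degrees. *)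

(* Defs.v *)
From HB Require Import structures.
From mathcomp Require Import all_boot all_order all_algebra.
From mathcomp Require Import boolp reals zify.
From Stdlib Require Import Relation_Operators.

Set Implicit Arguments.
Unset Strict Implicit.
Unset Printing Implicit Defensive.

Import GRing.Theory.
Local Open Scope ring_scope.
Local Open Scope quotient_scope.

Record submod (R : realType) (V : lmodType R) := Submod {
  smem :> V -> Prop;
  smem0 : smem 0;
  smemP : forall a x y, smem x -> smem y -> smem (a *: x + y)
}.

Section Subspace.
Variables (R : realType) (V : lmodType R) (S : submod V).

Definition smpred : {pred V} := fun x => `[< S x >].

Lemma smpred_closed : GRing.submod_closed smpred.
Proof.
split=> [|a x y /asboolP Sx /asboolP Sy]; apply/asboolP; first exact: smem0.
exact: smemP.
Qed.

HB.instance Definition _ := GRing.isSubmodClosed.Build R V smpred smpred_closed.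

Record subsp := Subsp { ssval : V; ssvalP : ssval \in smpred }.

HB.instance Definition _ := [isSub for ssval].
HB.instance Definition _ := [Choice of subsp by <:].
HB.instance Definition _ := [SubChoice_isSubLmodule of subsp by <:].

Lemma subsp_mem (x : subsp) : S (\val x).
Proof. exact/asboolP/(valP x). Qed.

Definition mksub (x : V) (Sx : S x) : subsp := Subsp (asboolT Sx).

End Subspace.

Section Restrict.
Variables (R : realType) (V W : lmodType R) (S : submod V) (T : submod W).
Variables (f : {linear V -> W}) (fST : forall x, S x -> T (f x)).

Definition restrict_fun (x : subsp S) : subsp T := mksub (fST (subsp_mem x)).

Lemma restrict_linear : linear restrict_fun.
Proof. by move=> a x y; apply/val_inj; rewrite /= linearP. Qed.

HB.instance Definition _ :=
  GRing.isLinear.Build R (subsp S) (subsp T) _ restrict_fun restrict_linear.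

Definition restrict : {linear subsp S -> subsp T} := restrict_fun.

End Restrict.

Section Corestrict.
Variables (R : realType) (V W : lmodType R) (T : submod W).
Variables (f : {linear V -> W}) (fT : forall x, T (f x)).

Definition corestrict_fun (x : V) : subsp T := mksub (fT x).

Lemma corestrict_linear : linear corestrict_fun.
Proof. by move=> a x y; apply/val_inj; rewrite /= linearP. Qed.

HB.instance Definition _ :=
  GRing.isLinear.Build R V (subsp T) _ corestrict_fun corestrict_linear.

Definition corestrict : {linear V -> subsp T} := corestrict_fun.

End Corestrict.

Section Kernel.
Variables (R : realType) (V W : lmodType R) (f : {linear V -> W}).

Lemma ker0 : f 0 = 0. Proof. exact: linear0. Qed.
Lemma kerP (a : R) x y : f x = 0 -> f y = 0 -> f (a *: x + y) = 0.
Proof. by move=> fx fy; rewrite linearP fx fy scaler0 addr0. Qed.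

Definition ker : submod V := @Submod R V (fun x => f x = 0) ker0 kerP.

End Kernel.

Definition dprod (R : realType) (I : Type) (V : I -> lmodType R) : Type :=
  forall i, V i.

Section DProd.
Variables (R : realType) (I : Type) (V : I -> lmodType R).

HB.instance Definition _ := gen_eqMixin (dprod V).
HB.instance Definition _ := gen_choiceMixin (dprod V).

Let add (x y : dprod V) : dprod V := fun i => x i + y i.
Let opp (x : dprod V) : dprod V := fun i => - x i.
Let zero : dprod V := fun i => 0.
Let scale (a : R) (x : dprod V) : dprod V := fun i => a *: x i.

Fact dprod_addA : associative add.
Proof. by move=> x y z; apply: functional_extensionality_dep => i; apply: addrA. Qed.
Fact dprod_addC : commutative add.
Proof. by move=> x y; apply: functional_extensionality_dep => i; apply: addrC. Qed.
Fact dprod_add0 : left_id zero add.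
Proof. by move=> x; apply: functional_extensionality_dep => i; apply: add0r. Qed.
Fact dprod_addN : left_inverse zero opp add.
Proof. by move=> x; apply: functional_extensionality_dep => i; apply: addNr. Qed.

HB.instance Definition _ :=
  GRing.isZmodule.Build (dprod V) dprod_addA dprod_addC dprod_add0 dprod_addN.

Fact dprod_scaleA a b x : scale a (scale b x) = scale (a * b) x.
Proof. by apply: functional_extensionality_dep => i; apply: scalerA. Qed.
Fact dprod_scale1 : left_id 1 scale.
Proof. by move=> x; apply: functional_extensionality_dep => i; apply: scale1r. Qed.
Fact dprod_scaleDr : right_distributive scale +%R.
Proof. by move=> a x y; apply: functional_extensionality_dep => i; apply: scalerDr. Qed.
Fact dprod_scaleDl x : {morph scale^~ x : a b / a + b}.
Proof. by move=> a b; apply: functional_extensionality_dep => i; apply: scalerDl. Qed.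

HB.instance Definition _ :=
  GRing.Zmodule_isLmodule.Build R (dprod V)
    dprod_scaleA dprod_scale1 dprod_scaleDr dprod_scaleDl.

End DProd.

Record chain (R : realType) := Chain {
  ch_ob :> nat -> lmodType R;
  ch_d : forall q, {linear ch_ob q.+1 -> ch_ob q};
  ch_dd : forall q x, ch_d q (ch_d q.+1 x) = 0
}.

Record chain_map (R : realType) (X Y : chain R) := ChainMap {
  cm_fun :> forall q, {linear X q -> Y q};
  cm_d : forall q x, cm_fun q (ch_d X q x) = ch_d Y q (cm_fun q.+1 x)
}.

Section Homology.
Variables (R : realType).
Implicit Types X Y : chain R.

Definition is_cycle X q : X q -> Prop :=
  match q return X q -> Prop with
  | 0 => fun=> True
  | q'.+1 => fun x => ch_d X q' x = 0
  end.

Lemma is_cycle0 X q : is_cycle (0 : X q).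
Proof. by case: q => //= q; rewrite linear0. Qed.

Lemma is_cycleP X q (a : R) (x y : X q) :
  is_cycle x -> is_cycle y -> is_cycle (a *: x + y).
Proof. by case: q x y => //= q x y; exact: kerP. Qed.

Definition cycles X q : submod (X q) := Submod (@is_cycle0 X q) (@is_cycleP X q).

Definition is_boundary X q (z : subsp (cycles X q)) : Prop :=
  exists y : X q.+1, ch_d X q y = \val z.

Lemma is_boundary0 X q : is_boundary (0 : subsp (cycles X q)).
Proof. by exists 0; rewrite linear0. Qed.

Lemma is_boundaryP X q (a : R) (x y : subsp (cycles X q)) :
  is_boundary x -> is_boundary y -> is_boundary (a *: x + y).
Proof.
by move=> [u ux] [v vy]; exists (a *: u + v); rewrite linearP ux vy.
Qed.

Definition boundaries X q : submod (subsp (cycles X q)) :=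
  Submod (@is_boundary0 X q) (@is_boundaryP X q).

Definition homology X q := Quotient.quot (smpred (boundaries X q)).

Lemma cycles_map X Y (f : chain_map X Y) q (x : X q) :
  cycles X q x -> cycles Y q (f q x).
Proof. by case: q x => //= q x dx; rewrite -cm_d dx linear0. Qed.

Definition homology_map X Y (f : chain_map X Y) q (h : homology X q) :
    homology Y q :=
  \pi_(homology Y q) (restrict (@cycles_map X Y f q) (repr h)).

Lemma homology_map_pi X Y (f : chain_map X Y) q (z : subsp (cycles X q)) :
  homology_map f (\pi_(homology X q) z)
  = \pi_(homology Y q) (restrict (@cycles_map X Y f q) z).
Proof.
rewrite /homology_map; apply/eqP; rewrite -Quotient.idealrBE -linearB.
have: repr (\pi_(homology X q) z) - z \in smpred (boundaries X q).
  by rewrite Quotient.idealrBE reprK.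
move=> /asboolP[y yE]; apply/asboolP; exists (f q.+1 y).
by rewrite -cm_d yE.
Qed.

(* A bijective linear map is an isomorphism of vector spaces. *)
Definition quasi_iso X Y (f : chain_map X Y) : Prop :=
  forall q, bijective (@homology_map X Y f q).

Definition degreewise_mono X Y (f : chain_map X Y) : Prop :=
  forall q, injective (f q).

(* Isomorphism in the homotopy category: a zigzag of quasi-isomorphisms. *)
Definition weakly_equivalent : chain R -> chain R -> Prop :=
  clos_refl_sym_trans (chain R) (fun X Y => exists f : chain_map X Y, quasi_iso f).

End Homology.

Definition monotone m n (f : {ffun 'I_m.+1 -> 'I_n.+1}) : bool :=
  [forall i : 'I_m.+1, forall j : 'I_m.+1, (i <= j)%N ==> (f i <= f j)%N].

(* Morphisms [m] -> [n] of the simplex category, with [n] = {0, ..., n}. *)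
Record simplex_map (m n : nat) := SimplexMap {
  sx_fun :> {ffun 'I_m.+1 -> 'I_n.+1};
  sx_monotone : monotone sx_fun
}.

HB.instance Definition _ m n := [isSub for @sx_fun m n].
HB.instance Definition _ m n := [Finite of simplex_map m n by <:].

Lemma monotoneP m n (f : {ffun 'I_m.+1 -> 'I_n.+1}) :
  reflect (forall i j : 'I_m.+1, (i <= j)%N -> (f i <= f j)%N) (monotone f).
Proof.
apply: (iffP forallP) => [H i j|H i]; first by move/forallP: (H i) => /(_ j)/implyP.
by apply/forallP => j; apply/implyP; exact: H.
Qed.

Lemma sx_idP n : monotone [ffun i : 'I_n.+1 => i].
Proof. by apply/monotoneP => i j; rewrite !ffunE. Qed.

Definition sx_id n : simplex_map n n := SimplexMap (sx_idP n).

Lemma sx_compP m n p (g : simplex_map n p) (f : simplex_map m n) :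
  monotone [ffun i => g (f i)].
Proof.
apply/monotoneP => i j ij; rewrite !ffunE.
exact/(monotoneP _ (sx_monotone g))/(monotoneP _ (sx_monotone f)).
Qed.

Definition sx_comp m n p (g : simplex_map n p) (f : simplex_map m n) :
  simplex_map m p := SimplexMap (sx_compP g f).

Lemma cofaceP n (i : 'I_n.+2) : monotone [ffun j : 'I_n.+1 => lift i j].
Proof. by apply/monotoneP => j k jk; rewrite !ffunE /= leq_bump2. Qed.

Definition coface n (i : 'I_n.+2) : simplex_map n n.+1 := SimplexMap (cofaceP i).

(* s^i : [n+1] -> [n], the surjection taking the value i twice;
   [unbump i j] is j - 1 if i < j and j otherwise. *)
Lemma codegen_lt n (i : 'I_n.+1) (j : 'I_n.+2) : (unbump i j < n.+1)%N.
Proof.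
rewrite /unbump; case: (ltnP i j) => ij; last first.
  by rewrite subn0; exact: leq_ltn_trans ij (ltn_ord i).
by rewrite subn1 prednK ?(leq_ltn_trans _ ij) // -ltnS.
Qed.

Lemma codegenP n (i : 'I_n.+1) :
  monotone [ffun j : 'I_n.+2 => Ordinal (codegen_lt i j)].
Proof.
apply/monotoneP => j k jk; rewrite !ffunE /= /unbump.
case: (ltnP i j) => ij; first by rewrite (leq_trans ij jk) leq_sub2r.
case: (ltnP i k) => ik; last by rewrite !subn0.
by rewrite subn0 subn1 -ltnS prednK ?(leq_ltn_trans ij ik) ?(leq_ltn_trans _ ik).
Qed.

Definition codegen n (i : 'I_n.+1) : simplex_map n.+1 n := SimplexMap (codegenP i).

Lemma sx_eqP m n (f g : simplex_map m n) : (forall i, f i = g i :> nat) -> f = g.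
Proof. by move=> fg; apply/val_inj/ffunP => i; apply/val_inj/fg. Qed.

Lemma coface_coface n (j : 'I_n.+3) (i : 'I_n.+2) (i' : 'I_n.+3) (j' : 'I_n.+2) :
  (i < j)%N -> i' = i :> nat -> j' = j.-1 :> nat ->
  sx_comp (coface j) (coface i) = sx_comp (coface i') (coface j').
Proof.
by move=> ij Ei Ej; apply/sx_eqP => k; rewrite !ffunE /= Ei Ej /bump; lia.
Qed.

Lemma codegen_coface_id n (j : 'I_n.+1) (i : 'I_n.+2) :
  (i == j :> nat) || (i == j.+1 :> nat) ->
  sx_comp (codegen j) (coface i) = sx_id n.
Proof. by move=> ij; apply/sx_eqP => k; rewrite !ffunE /= /bump /unbump; lia. Qed.

Lemma codegen_coface n (j : 'I_n.+2) (i : 'I_n.+3) :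
  ~~ ((i == j :> nat) || (i == j.+1 :> nat)) ->
  exists (i' : 'I_n.+2) (j' : 'I_n.+1),
    sx_comp (codegen j) (coface i) = sx_comp (coface i') (codegen j').
Proof.
move=> ij; have ltj := ltn_ord j; have lti := ltn_ord i.
have [ltij|leji] := ltnP i j.
  have i'P : (i < n.+2)%N by lia.
  have j'P : (j.-1 < n.+1)%N by lia.
  exists (Ordinal i'P), (Ordinal j'P).
  by apply/sx_eqP => k; rewrite !ffunE /= /bump /unbump; lia.
have i'P : (i.-1 < n.+2)%N by lia.
have j'P : (j < n.+1)%N by lia.
exists (Ordinal i'P), (Ordinal j'P).
by apply/sx_eqP => k; rewrite !ffunE /= /bump /unbump; lia.
Qed.

Record cosimplicial (R : realType) := Cosimplicial {
  cs_ob :> nat -> chain R;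
  cs_act : forall m n, simplex_map m n -> chain_map (cs_ob m) (cs_ob n);
  cs_id : forall n q x, cs_act (sx_id n) q x = x;
  cs_comp : forall m n p (g : simplex_map n p) (f : simplex_map m n) q x,
    cs_act (sx_comp g f) q x = cs_act g q (cs_act f q x)
}.

Record cosimplicial_map (R : realType) (A B : cosimplicial R) := CosimplicialMap {
  csm_fun :> forall n, chain_map (A n) (B n);
  csm_nat : forall m n (f : simplex_map m n) q x,
    csm_fun n q (cs_act A f q x) = cs_act B f q (csm_fun m q x)
}.

Section Holim.
Variable R : realType.

Definition is_cone (F : cosimplicial R) (L : chain R)
    (pr : forall n, chain_map L (F n)) : Prop :=
  forall m n (f : simplex_map m n) q x, cs_act F f q (pr m q x) = pr n q x.

Definition is_limit (F : cosimplicial R) (L : chain R)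
    (pr : forall n, chain_map L (F n)) : Prop :=
  is_cone pr /\
  forall (T : chain R) (t : forall n, chain_map T (F n)), is_cone t ->
    exists h : chain_map T L,
      (forall n q x, pr n q (h q x) = t n q x) /\
      (forall h' : chain_map T L,
        (forall n q x, pr n q (h' q x) = t n q x) -> forall q x, h' q x = h q x).

(* In the injective model structure on cosimplicial objects of the projective
   model category of chain complexes, weak equivalences and cofibrations are
   objectwise, i.e. levelwise quasi-isomorphisms and levelwise degreewise
   monomorphisms. *)
Definition levelwise_quasi_iso (A B : cosimplicial R) (f : cosimplicial_map A B) :=
  forall n, quasi_iso (f n).

Definition levelwise_mono (A B : cosimplicial R) (f : cosimplicial_map A B) :=
  forall n, degreewise_mono (f n).

(* F -> 0 has the right lifting property against the trivial cofibrations. *)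
Definition injectively_fibrant (F : cosimplicial R) : Prop :=
  forall (A B : cosimplicial R) (i : cosimplicial_map A B),
    levelwise_mono i -> levelwise_quasi_iso i ->
  forall f : cosimplicial_map A F, exists g : cosimplicial_map B F,
    forall n q x, g n q (i n q x) = f n q x.

(* The homotopy limit is the right derived functor of the limit, right Quillen
   for the injective model structure: the limit of a fibrant replacement. It is
   defined only up to weak equivalence, hence the relation. *)
Definition is_holim (C : cosimplicial R) (L : chain R) : Prop :=
  exists (F : cosimplicial R) (j : cosimplicial_map C F)
         (pr : forall n, chain_map L (F n)),
    [/\ levelwise_quasi_iso j, injectively_fibrant F & is_limit pr].

End Holim.

Section Normalized.
Variables (R : realType) (C : cosimplicial R).

Definition is_normalized p q : C p q -> Prop :=
  match p return C p q -> Prop with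
  | 0 => fun=> True
  | p'.+1 => fun x => forall i : 'I_p'.+1, cs_act C (codegen i) q x = 0
  end.

Lemma is_normalized0 p q : is_normalized (0 : C p q).
Proof. by case: p => //= p i; rewrite linear0. Qed.

Lemma is_normalizedP p q (a : R) (x y : C p q) :
  is_normalized x -> is_normalized y -> is_normalized (a *: x + y).
Proof. by case: p x y => //= p x y Nx Ny i; apply: kerP. Qed.

Definition normalized p q : submod (C p q) :=
  Submod (@is_normalized0 p q) (@is_normalizedP p q).

Definition Ncx p q : lmodType R := subsp (normalized p q).

Lemma normalized_d p q (x : C p q.+1) :
  normalized p q.+1 x -> normalized p q (ch_d (C p) q x).
Proof. by case: p x => //= p x Nx i; rewrite cm_d Nx linear0. Qed.

Definition Nd p q : {linear Ncx p q.+1 -> Ncx p q} := restrict (@normalized_d p q).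

Definition delta_fun p q (x : C p q) : C p.+1 q :=
  \sum_(i < p.+2) (-1) ^+ i *: cs_act C (coface i) q x.

Lemma delta_linear p q : linear (@delta_fun p q).
Proof.
move=> a x y; rewrite /delta_fun scaler_sumr -big_split; apply: eq_bigr => i _ /=.
by rewrite linearP scalerDr !scalerA mulrC.
Qed.

HB.instance Definition _ p q :=
  GRing.isLinear.Build R (C p q) (C p.+1 q) _ (@delta_fun p q) (@delta_linear p q).

Definition delta p q : {linear C p q -> C p.+1 q} := @delta_fun p q.

Lemma codegen_delta p q (x : C p q) (j : 'I_p.+1) :
  normalized p q x -> cs_act C (codegen j) q (delta p q x) = 0.
Proof.
move=> Nx; rewrite linear_sum /=.
have jlt := ltn_ord j.
pose i0 : 'I_p.+2 := widen_ord (leqnSn _) j.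
pose i1 : 'I_p.+2 := lift ord0 j.
have i10 : i1 != i0 by apply/eqP => /(congr1 val) /=; rewrite /bump; lia.
rewrite (bigD1 i0) //= (bigD1 i1) //= big1 => [|i /andP[ni0 ni1]].
  rewrite addr0 !linearZ /= -!cs_comp !codegen_coface_id ?cs_id /= ?eqxx ?orbT //.
  by rewrite /bump /= add1n exprS mulN1r scaleNr subrr.
rewrite linearZ /= -cs_comp.
have : ~~ ((i == j :> nat) || (i == j.+1 :> nat)).
  by rewrite negb_or; apply/andP; split.
case: p x j Nx jlt @i0 @i1 i10 i ni0 ni1 => [|p] x j Nx jlt i0 i1 i10 i ni0 ni1.
  by have := ltn_ord i; lia.
move=> /codegen_coface[i' [j' ->]].
by rewrite cs_comp Nx linear0 scaler0.
Qed.

Lemma normalized_delta p q (x : C p q) :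
  normalized p q x -> normalized p.+1 q (delta p q x).
Proof. by move=> Nx j; apply: codegen_delta. Qed.

Definition Ndelta p q : {linear Ncx p q -> Ncx p.+1 q} :=
  restrict (@normalized_delta p q).

Lemma alternating_sum_sum0 (V : lmodType R) n (f : nat -> nat -> V) :
  (forall i j, (i < j <= n)%N -> f j i = f i j.-1) ->
  \sum_(j < n.+1) (-1) ^+ j *: \sum_(i < n) (-1) ^+ i *: f j i = 0.
Proof.
move=> fij.
transitivity (\sum_(j < n.+1) \sum_(i < n) (-1) ^+ (j + i) *: f j i).
  by apply: eq_bigr => j _; rewrite scaler_sumr; apply: eq_bigr => i _;
     rewrite scalerA exprD.
under eq_bigr => j _ do rewrite (bigID (fun i : 'I_n => (i < j)%N)) /=.
rewrite big_split /= big_ord_recl /= big1 ?add0r; last by move=> i; rewrite ltn0.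
rewrite [X in _ + X]big_ord_recr /= [X in _ + (_ + X)]big1 ?addr0; last first.
  by move=> i; rewrite ltn_ord.
under [X in _ + X]eq_bigr => j _ do rewrite big_mkcond /=.
rewrite [X in _ + X]exchange_big /=.
under [X in _ + X]eq_bigr => j _ do rewrite -big_mkcond /=.
rewrite -big_split big1 // => j _ /=.
rewrite [X in _ + X](eq_bigl (fun i : 'I_n => (i < bump 0 j)%N)); last first.
  by move=> i; rewrite /bump; lia.
rewrite -big_split big1 // => i /=; rewrite /bump leq0n add1n ltnS => ij.
rewrite fij ?ltnS ?ij ?ltn_ord //= addSn exprS mulN1r scaleNr addnC.
exact: addNr.
Qed.

Lemma delta_delta p q (x : C p q) : delta p.+1 q (delta p q x) = 0.
Proof.
pose f j i := cs_act C (coface (inord j : 'I_p.+3)) q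
  (cs_act C (coface (inord i : 'I_p.+2)) q x).
rewrite -[RHS](@alternating_sum_sum0 _ p.+2 f) => [|i j /andP[ij jp]].
  apply: eq_bigr => j _; congr (_ *: _); rewrite linear_sum.
  by apply: eq_bigr => i _; rewrite /f linearZ /= !inord_val.
rewrite /f -!cs_comp; congr (cs_act C _ q x).
by apply: coface_coface; rewrite !inordK; lia.
Qed.

Lemma delta_d p q (x : C p q.+1) :
  ch_d (C p.+1) q (delta p q.+1 x) = delta p q (ch_d (C p) q x).
Proof.
rewrite linear_sum; apply: eq_bigr => i _ /=.
by rewrite linearZ /= -cm_d.
Qed.

End Normalized.

Record zchain (R : realType) := ZChain {
  zch_ob :> int -> lmodType R;
  zch_d : forall k, {linear zch_ob k -> zch_ob (k - 1)};
  zch_dd : forall k x, zch_d (k - 1) (zch_d k x) = 0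
}.

Section Truncation.
Variables (R : realType) (X : zchain R).

Definition trunc_ob (n : nat) : lmodType R :=
  match n with
  | 0 => subsp (ker (zch_d X 0))
  | m.+1 => X (Posz m.+1)
  end.

Definition trunc_d (n : nat) : {linear trunc_ob n.+1 -> trunc_ob n} :=
  match n return {linear trunc_ob n.+1 -> trunc_ob n} with
  | 0 => @corestrict R (X 1) (X 0) (ker (zch_d X 0)) (zch_d X 1) (zch_dd (k := 1))
  | m.+1 => zch_d X (Posz m.+2)
  end.

Lemma trunc_dd n x : trunc_d n (trunc_d n.+1 x) = 0.
Proof.
case: n x => [|n] x; last exact: (@zch_dd R X (Posz n.+3)).
by apply/val_inj; exact: (@zch_dd R X (Posz 2)).
Qed.

Definition smart_trunc : chain R := Chain trunc_dd.

End Truncation.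

Section Tot.
Variables (R : realType) (C : cosimplicial R).

Definition bigraded : lmodType R :=
  dprod (fun pq : nat * nat => Ncx C pq.1 pq.2).

(* The product of the [Ncx C p q] over q - p = k, as the families indexed by all
   (p, q) that vanish off the line q - p = k. *)
Definition on_line (k : int) (x : bigraded) : Prop :=
  forall p q : nat, q%:Z - p%:Z != k -> x (p, q) = 0.

Lemma on_line0 k : on_line k 0.
Proof. by []. Qed.

Lemma on_lineP k (a : R) (x y : bigraded) :
  on_line k x -> on_line k y -> on_line k (a *: x + y).
Proof.
move=> kx ky p q pq; rewrite -[LHS]/(a *: x (p, q) + y (p, q)).
by rewrite kx // ky // scaler0 addr0.
Qed.

Definition line k : submod bigraded :=
  Submod (@on_line0 k) (@on_lineP k).

(* D = d - (-1)^(q-p) delta, where (p, q) is the bidegree of the argument. *)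
Definition D_fun (x : bigraded) : bigraded := fun pq =>
  match pq return Ncx C pq.1 pq.2 with
  | (0, q) => Nd C 0 q (x (0, q.+1)%N)
  | (p.+1, q) => Nd C p.+1 q (x (p.+1, q.+1))
                 - (-1) ^ (q%:Z - p%:Z) *: Ndelta C p q (x (p, q))
  end.

Lemma D_linear : linear D_fun.
Proof.
move=> a x y; apply: functional_extensionality_dep => -[[|p] q].
  exact: (linearP (Nd C 0 q)).
rewrite -[RHS]/(a *: D_fun x (p.+1, q) + D_fun y (p.+1, q)) /D_fun.
rewrite -[(a *: x + y) (p.+1, q.+1)]/(a *: x (p.+1, q.+1) + y (p.+1, q.+1)).
rewrite -[(a *: x + y) (p, q)]/(a *: x (p, q) + y (p, q)).
rewrite (linearP (Nd C p.+1 q)) (linearP (Ndelta C p q)) scalerDr opprD addrACA.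
by rewrite scalerBr !scalerA mulrC.
Qed.

HB.instance Definition _ :=
  GRing.isLinear.Build R bigraded bigraded _ D_fun D_linear.

Definition D : {linear bigraded -> bigraded} := D_fun.

Lemma line_D k x : line k x -> line (k - 1) (D x).
Proof.
move=> kx [|p] q pq /=; first by rewrite kx ?linear0 //; lia.
have -> : x (p.+1, q.+1) = 0 by apply: kx; lia.
have -> : x (p, q) = 0 by apply: kx; lia.
by rewrite !linear0 addr0.
Qed.

Lemma Nd_Nd p q (y : Ncx C p q.+2) : Nd C p q (Nd C p q.+1 y) = 0.
Proof. by apply/val_inj; exact: ch_dd. Qed.

Lemma Ndelta_Ndelta p q (y : Ncx C p q) :
  Ndelta C p.+1 q (Ndelta C p q y) = 0.
Proof. by apply/val_inj; exact: delta_delta. Qed.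

Lemma Nd_Ndelta p q (y : Ncx C p q.+1) :
  Nd C p.+1 q (Ndelta C p q.+1 y) = Ndelta C p q (Nd C p q y).
Proof. by apply/val_inj; exact: delta_d. Qed.

Lemma D_D x : D (D x) = 0.
Proof.
have sgn (p q : nat) : (-1) ^ (q.+1%:Z - p%:Z) = - (-1) ^ (q%:Z - p%:Z) :> R.
  have -> : q.+1%:Z - p%:Z = 1 + (q%:Z - p%:Z) by lia.
  by rewrite expfzDr ?oppr_eq0 ?oner_eq0 // expr1z mulN1r.
apply: functional_extensionality_dep => -[[|p] q] /=; first exact: Nd_Nd.
rewrite linearB linearZ /= Nd_Nd Nd_Ndelta sgn sub0r scaleNr opprK.
case: p => [|p]; first by rewrite subrr.
rewrite (linearB (Ndelta C p.+1 q)) (linearZ_LR (Ndelta C p.+1 q)).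
by rewrite Ndelta_Ndelta scaler0 subr0 subrr.
Qed.

Definition totZ_d k : {linear subsp (line k) -> subsp (line (k - 1))} :=
  restrict (@line_D k).

Lemma totZ_dd k x : totZ_d (k - 1) (totZ_d k x) = 0.
Proof. by apply/val_inj; exact: D_D. Qed.

Definition totZ : zchain R := ZChain totZ_dd.

Definition tot : chain R := smart_trunc totZ.

End Tot.

(* Main.v *)
From HB Require Import structures.
Require Import Defs.
From mathcomp Require Import all_boot all_order all_algebra.
From mathcomp Require Import boolp classical_sets reals zify.
From Stdlib Require Import Relation_Operators.

(** Delta-diagrams X of chain complexes embed into the cofree ones
    G X, (G X)^p = prod_([p] -> [n]) X^n, through the unit of an adjunction whose
    counit splits it naturally in X, but not in p. Iterating gives a resolution
    C -> G C -> G G C -> ... by cofree objects which is contractible in each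
    cosimplicial degree; the truncated product total complex fibrep C of this resolution
    receives a levelwise quasi-isomorphism from C. It is injectively fibrant: a map
    from B to G X is a family of unnatural maps B^n -> X^n, and those extend along a
    trivial cofibration by means of a deformation retraction of B^n onto A^n, one
    filtration degree at a time. So lim (fibrep C) is a homotopy limit.

    For an arbitrary fibrant F with C -> F a levelwise quasi-isomorphism, compare
    lim F -> tot F <- tot C. The map on the right is a quasi-isomorphism because the
    normalized columns are natural retracts of the columns, and a product total
    complex can be solved column by column. For the map on the left, F is a retract
    of fibrep F, and the claim for fibrep F is solved by induction on the resolution degree,
    from the contraction of the cofree rows onto their limit given by the cone with
    vertex 0. *)

Set Implicit Arguments.
Unset Strict Implicit.
Unset Printing Implicit Defensive.

Import GRing.Theory.
Local Open Scope ring_scope.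
Local Open Scope quotient_scope.

(** * Linear algebra *)

Section LinearAlgebra.
Variable R : realType.
Implicit Types V W : lmodType R.

Lemma submodZ V (S : submod V) a x : S x -> S (a *: x).
Proof. by move=> Sx; rewrite -[_ *: _]addr0; apply: smemP => //; exact: smem0. Qed.

Lemma submodB V (S : submod V) x y : S x -> S y -> S (x - y).
Proof. by move=> Sx Sy; rewrite addrC -scaleN1r; apply: smemP. Qed.

(** Zorn's lemma for the subspaces that meet [S] only in 0. A vector outside the sum of [S] and a
    maximal such subspace could be adjoined to the latter, since dividing by its coefficient would
    otherwise place it in the sum. *)
Lemma submod_complement V (S : submod V) :
  exists T : submod V, (forall x, S x -> T x -> x = 0) /\
    forall x, exists2 u, S u & T (x - u).
Proof.
(* Zorn_bigcup requires the empty set to be admissible, so 0 is added at the end. *)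
pose P (A : set V) := (forall x, A x -> S x -> x = 0) /\
  (forall a x y, A x -> A y -> A (a *: x + y)).
have [|A [[AS0 AP] maxA]] := @Zorn_bigcup V P.
  move=> F FP Ftot; split=> [x [A FA Ax]|a x y [A FA Ax] [B FB By]].
    exact: (FP A FA).1.
  have [AB|BA] := Ftot A B FA FB.
    by exists B => //; apply: (FP B FB).2 => //; exact: AB.
  by exists A => //; apply: (FP A FA).2 => //; exact: BA.
pose T x := x = 0 \/ A x.
have T0 : T 0 by left.
have TP a x y : T x -> T y -> T (a *: x + y).
  move=> [->|Ax] [->|Ay]; first by left; rewrite scaler0 addr0.
  - by right; rewrite scaler0 add0r.
  - by right; apply/AP => //; rewrite -(addNr x) -scaleN1r; apply/AP.
  - by right; apply/AP.
pose TT := Submod T0 TP.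
exists TT; split=> [x Sx [//|Ax]|x]; first exact: AS0.
apply: contrapT => nx.
pose B y := exists c t, T t /\ y = c *: x + t.
apply: (maxA B).
  split=> [y Ay|BA]; first by exists 0, y; split; [right|rewrite scale0r add0r].
  apply: nx; exists 0; first exact: smem0.
  by right; apply: BA; exists 1, 0; split=> //; rewrite scale1r subr0 addr0.
split=> [_ [c [t [Tt ->]]] Su|a _ _ [c [t [Tt ->]]] [c' [t' [Tt' ->]]]].
  have [c0|c0] := eqVneq c 0.
    move: Su; rewrite c0 scale0r add0r => St.
    by case: Tt => // At; exact: AS0.
  case: nx; exists (c^-1 *: (c *: x + t)); first exact: submodZ.
  rewrite scalerDr scalerA mulVf // scale1r opprD addrA subrr add0r -scaleNr.
  exact: (submodZ (S := TT)).
exists (a * c + c'), (a *: t + t'); split; first by apply/TP.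
by rewrite scalerDr scalerA addrACA scalerDl.
Qed.

Lemma submod_projection V (S : submod V) :
  exists e : {linear V -> V}, (forall x, S (e x)) /\ forall x, S x -> e x = x.
Proof.
have [T [ST0 VT]] := submod_complement S.
have VT' x : exists u, S u /\ T (x - u) by have [u] := VT x; exists u.
have [e eP] := choice VT'.
have eE x u : S u -> T (x - u) -> e x = u.
  move=> Su Tu; have [Se Te] := eP x; apply/eqP; rewrite -subr_eq0; apply/eqP.
  apply: ST0; first exact: submodB.
  rewrite -opprB -scaleN1r; apply: submodZ.
  have -> : u - e x = (x - e x) - (x - u) by rewrite opprB [RHS]addrC addrA subrK.
  exact: submodB.
have elin : linear e.
  move=> a x y; have [[Sx Tx] [Sy Ty]] := (eP x, eP y).
  apply: eE; first exact: smemP.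
  rewrite opprD addrACA -scalerBr; exact: smemP.
pose eL := GRing.isLinear.Build R V V _ e elin.
pose f : {linear V -> V} := HB.pack e eL.
exists f; split=> [x|x Sx]; first exact: (eP x).1.
by apply: eE => //; rewrite subrr; exact: smem0.
Qed.

Definition linear_pack V W (f : V -> W) (fl : linear f) : {linear V -> W} :=
  HB.pack f (GRing.isLinear.Build R V W _ f fl).

Lemma image_submod_subproof0 V W (f : {linear V -> W}) : exists x, f x = 0.
Proof. by exists 0; rewrite linear0. Qed.

Lemma image_submod_subproofP V W (f : {linear V -> W}) (a : R) y y' :
  (exists x, f x = y) -> (exists x, f x = y') -> exists x, f x = a *: y + y'.
Proof. by move=> [x <-] [x' <-]; exists (a *: x + x'); rewrite linearP. Qed.

Definition image_submod V W (f : {linear V -> W}) : submod W :=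
  @Submod R W (fun y => exists x, f x = y)
    (image_submod_subproof0 f) (image_submod_subproofP (f := f)).

(** Preimages chosen pointwise are not linear in their argument; subtracting their component in the
    kernel of [f] removes the dependence on the choice. Projecting onto the image first defines the
    inverse everywhere. *)
Lemma pseudo_inverse V W (f : {linear V -> W}) :
  exists g : {linear W -> V}, forall x, f (g (f x)) = f x.
Proof.
have [k [kf kK]] := submod_projection (ker f).
have [e [ef eK]] := submod_projection (image_submod f).
have [v vE] := choice ef.
pose g y := v y - k (v y).
have gE y x : f x = e y -> g y = x - k x.
  move=> fx; have /kK : ker f (v y - x) by rewrite /= linearB vE fx subrr.
  rewrite linearB => /eqP; rewrite subr_eq => /eqP kE.
  by rewrite /g kE opprD addrA subKr.
have glin : linear g.
  move=> a y y'; rewrite (gE _ (a *: v y + v y')); last by rewrite !linearP !vE.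
  by rewrite /g linearP scalerBr opprD addrACA.
exists (linear_pack glin) => x; rewrite -[LHS]/(f (g (f x))).
have xE : f x = e (f x) by rewrite eK //; exists x.
by rewrite (gE _ x xE) linearB (kf x) subr0.
Qed.

End LinearAlgebra.

(** * Quasi-isomorphisms as a relative lifting property *)

Lemma dependent_choice_fun I (T : I -> Type) (P : forall i, T i -> Prop) :
  (forall i, exists t, P i t) -> exists f : forall i, T i, forall i, P i (f i).
Proof.
by move=> H; exists (fun i => projT1 (cid (H i))) => i; exact: projT2 (cid (H i)).
Qed.

Section QuasiIso.
Variable R : realType.
Implicit Types X Y : chain R.

Lemma homology_eq X q (x y : subsp (cycles X q)) :
  \pi_(homology X q) x = \pi_(homology X q) y <->
  exists u, ch_d X q u = \val x - \val y.
Proof.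
split=> [/eqP|[u uE]]; last apply/eqP; rewrite -Quotient.idealrBE.
  by move=> /asboolP[u uE]; exists u; rewrite uE.
by apply/asboolP; exists u; rewrite uE.
Qed.

(** Acyclicity of the mapping cone of [f], on elements: [(a, b)] is a cycle of the cone and
    [(a', b')] bounds it, up to signs. This form avoids quotients and suits column-by-column
    solving. *)
Definition relative_lifting X Y (f : chain_map X Y) (q : nat) : Prop :=
  match q with
  | 0 => forall b : Y 0, exists a' b', b = f 0 a' + ch_d Y 0 b'
  | q'.+1 => forall (a : X q') (b : Y q'.+1), is_cycle a ->
      ch_d Y q' b = f q' a ->
      exists a' b', ch_d X q' a' = a /\ b = f q'.+1 a' + ch_d Y q'.+1 b'
  end.

(** With [a = 0] the lifting is surjectivity on homology, and its first component is injectivity.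
    Conversely, injectivity provides a primitive of [a], and surjectivity absorbs the cycle that
    then remains of [b]. *)
Lemma quasi_isoP X Y (f : chain_map X Y) :
  quasi_iso f <-> forall q, relative_lifting f q.
Proof.
split=> [qf q|fL q].
  have surj n (y : Y n) : is_cycle y ->
      exists x, is_cycle x /\ exists v, y = f n x + ch_d Y n v.
    move=> cy; have [g _ gK] := qf n.
    pose h := g (\pi_(homology Y n) (mksub (S := cycles Y n) cy)).
    have := gK (\pi_(homology Y n) (mksub (S := cycles Y n) cy)).
    rewrite -/h -[h]reprK homology_map_pi => /esym/homology_eq[v vE].
    exists (\val (repr h)); split; first exact: subsp_mem.
    by exists v; rewrite vE /= addrC subrK.
  have inj n (x : X n) (v : Y n.+1) : is_cycle x -> f n x = ch_d Y n v ->
      exists u, ch_d X n u = x.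
    move=> cx fx; have [g fK _] := qf n.
    have : \pi_(homology X n) (mksub (S := cycles X n) cx) = \pi_(homology X n) 0.
      apply: (can_inj fK); rewrite !homology_map_pi; apply/homology_eq.
      by exists v; rewrite /= linear0 subr0 fx.
    by move=> /homology_eq[u uE]; exists u; rewrite uE /= subr0.
  case: q => [b|q a b ca db].
    by have [x [_ [v ->]]] := surj 0 b I; exists x, v.
  have [a0 a0E] := inj _ _ _ ca (esym db).
  have [|x [cx [v vE]]] := surj q.+1 (b - f q.+1 a0).
    by rewrite /= linearB db -cm_d a0E subrr.
  exists (a0 + x), v; rewrite linearD a0E cx addr0 linearD -addrA -vE.
  by rewrite addrC subrK.
have inj : injective (@homology_map _ _ _ f q).
  move=> h h'; rewrite -[h]reprK -[h']reprK !homology_map_pi => /homology_eq[v].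
  rewrite /= -linearB => vE; apply/homology_eq.
  have := fL q.+1 (\val (repr h) - \val (repr h')) v.
  case=> [|//|a' [b' [aE _]]]; last by exists a'.
  by apply: (submodB (S := cycles X q)); apply: subsp_mem.
have surj (h : homology Y q) : exists k, homology_map f k = h.
  suff [x [v vE]] : exists (x : subsp (cycles X q)) v,
      \val (repr h) = f q (\val x) + ch_d Y q v.
    exists (\pi_(homology X q) x); rewrite homology_map_pi -[h]reprK.
    apply/homology_eq; exists (- v).
    by rewrite vE /= linearN opprD addrA subrr add0r.
  case: q h inj => [|q] h _.
    have [a' [b' bE]] := fL 0 (\val (repr h)).
    by exists (mksub (S := cycles X 0) (I : cycles X 0 a')), b'.
  have := fL q.+1 0 (\val (repr h)); case=> [||a' [b' [aE bE]]].
  - exact: is_cycle0.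
  - by rewrite linear0; have := subsp_mem (repr h).
  - by exists (mksub (S := cycles X q.+1) aE), b'.
have [g gE] := choice surj.
by exists g => // h; apply: inj.
Qed.

End QuasiIso.

(** * Deformation retractions along trivial cofibrations *)

Section DeformationRetract.
Variables (R : realType) (A B : chain R) (i : chain_map A B).
Hypotheses (i_mono : degreewise_mono i) (i_qi : quasi_iso i).

(** The vanishing of [h] on the image of [i] is what makes the extension built from [r] and [h]
    restrict to the given map. *)
Definition is_deformation_retraction (r : forall q, {linear B q -> A q})
    (h : forall q, {linear B q -> B q.+1}) : Prop :=
  [/\ forall q a, r q (i q a) = a,
      forall q b, r q (ch_d B q b) = ch_d A q (r q.+1 b),
      forall q a, h q (i q a) = 0,
      forall b, ch_d B 0 (h 0 b) = b - i 0 (r 0 b) &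
      forall q b, ch_d B q.+1 (h q.+1 b) = b - i q.+1 (r q.+1 b) - h q (ch_d B q b)].

(* Split B as i(A) + K degreewise, with K = ker s; then f = pi d is the differential
   of the acyclic quotient complex K, which h contracts. *)
Lemma deformation_retraction : exists r h, is_deformation_retraction r h.
Proof.
have /dependent_choice_fun[s sE] q : exists g : {linear B q -> A q}, forall a, g (i q a) = a.
  have [g gE] := pseudo_inverse (i q).
  by exists g => a; apply: i_mono; rewrite gE.
have [pi piE] : exists pi : forall q, {linear B q -> B q},
    forall q b, pi q b = b - i q (s q b).
  by exists (fun q => idfun \- (i q \o s q)).
have pi_i q a : pi q (i q a) = 0 by rewrite piE sE subrr.
have pi_pi q b : pi q (pi q b) = pi q b.
  by rewrite {1}[pi q b]piE linearB pi_i subr0.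
have [f fE] : exists f : forall q, {linear B q.+1 -> B q},
    forall q b, f q b = pi q (ch_d B q b).
  by exists (fun q => pi q \o ch_d B q).
have f_i q a : f q (i q.+1 a) = 0 by rewrite fE -cm_d pi_i.
have f_pi q b : f q (pi q.+1 b) = f q b by rewrite piE linearB f_i subr0.
have pi_f q b : pi q (f q b) = f q b by rewrite fE pi_pi.
have f_f q b : f q (f q.+1 b) = 0 by rewrite [f q.+1 b]fE f_pi fE ch_dd linear0.
have /quasi_isoP iL := i_qi.
have exact0 b : exists y, pi 0 b = f 0 y.
  by have [a [y ->]] := iL 0 b; exists y; rewrite linearD pi_i add0r fE.
have exactS q b : f q b = 0 -> exists y, pi q.+1 b = f q.+1 y.
  move=> fb; have db : ch_d B q b = i q (s q (ch_d B q b)).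
    by apply/eqP; rewrite -subr_eq0 -piE -fE fb.
  have [|a' [y [_ ->]]] := iL q.+1 _ _ _ db; last first.
    by exists y; rewrite linearD pi_i add0r fE.
  case: q b {fb} db => //= q b db.
  by apply: i_mono; rewrite cm_d linear0 -db ch_dd.
have /dependent_choice_fun[g gE] q : exists g : {linear B q -> B q.+1},
    forall x, f q (g (f q x)) = f q x.
  exact: pseudo_inverse.
(* The element [pi b - h (f b)] is an [f]-cycle of the complement, hence an [f]-boundary, and the
   pseudo-inverse [g] picks a preimage linearly. The outcome is [f h + h f = pi]. *)
have [h h0E hSE] : exists2 h : forall q, {linear B q -> B q.+1},
    forall b, h 0 b = pi 1 (g 0 (pi 0 b)) &
    forall q b, h q.+1 b = pi q.+2 (g q.+1 (pi q.+1 b - h q (f q b))).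
  by exists (fix h q : {linear B q -> B q.+1} :=
    match q return {linear B q -> B q.+1} with
    | 0 => pi 1 \o (g 0 \o pi 0)
    | q'.+1 => pi q'.+2 \o (g q'.+1 \o (pi q'.+1 \- (h q' \o f q')))
    end).
have h_i q a : h q (i q a) = 0.
  case: q a => [|q] a; first by rewrite h0E pi_i !linear0.
  by rewrite hSE pi_i f_i linear0 subrr !linear0.
have pi_h q b : pi q.+1 (h q b) = h q b.
  by case: q b => [|q] b; rewrite ?h0E ?hSE pi_pi.
have fh0 b : f 0 (h 0 b) = pi 0 b.
  by have [y yE] := exact0 b; rewrite h0E f_pi yE gE.
have fhS q b : f q.+1 (h q.+1 b) = pi q.+1 b - h q (f q b).
  have fhf : f q (h q (f q b)) = f q b.
    elim: q b => [|q IHq] b; first by rewrite fh0 pi_f.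
    have [|y yE] := exactS q (pi q.+1 (f q.+1 b) - h q (f q (f q.+1 b))).
      by rewrite f_f linear0 subr0 pi_f f_f.
    by rewrite hSE f_pi; move: yE; rewrite f_f linear0 subr0 !pi_f => ->; rewrite gE.
  have [|y] := exactS q (pi q.+1 b - h q (f q b)).
    by rewrite linearB f_pi fhf subrr.
  by rewrite linearB pi_pi pi_h hSE f_pi => ->; rewrite gE.
have hE q b : h q b = h q (pi q b).
  by rewrite piE linearB h_i subr0.
have h_f q b : h q (f q b) = h q (ch_d B q b) by rewrite fE -hE.
have pi0 q b : pi q b = 0 -> b = i q (s q b).
  by move=> /eqP; rewrite piE subr_eq0 => /eqP.
(* The chain map [e = 1 - d h - h d] fixes the image of [i], and [pi] kills its values, so they lie
   in that image; composing with [s] gives the retraction. *)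
have [e e0E eSE] : exists2 e : forall q, {linear B q -> B q},
    forall b, e 0 b = b - ch_d B 0 (h 0 b) &
    forall q b, e q.+1 b = b - ch_d B q.+1 (h q.+1 b) - h q (ch_d B q b).
  by exists (fun q => match q return {linear B q -> B q} with
    | 0 => idfun \- (ch_d B 0 \o h 0)
    | q'.+1 => idfun \- (ch_d B q'.+1 \o h q'.+1) \- (h q' \o ch_d B q')
    end).
have e_A q b : e q b = i q (s q (e q b)).
  apply: pi0; case: q b => [|q] b.
    by rewrite e0E linearB -fE fh0 subrr.
  by rewrite eSE !linearB -fE fhS pi_h h_f opprB addrCA addrN addr0 addrN.
have e_d q b : e q (ch_d B q b) = ch_d B q (e q.+1 b).
  case: q b => [|q] b; first by rewrite e0E eSE !linearB ch_dd subr0.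
  by rewrite !eSE !linearB !ch_dd linear0 !subr0.
exists (fun q => s q \o e q), h; split=> [q a|q b|||] //=.
- have -> : e q (i q a) = i q a; last exact: sE.
  case: q a => [|q] a; first by rewrite e0E h_i linear0 subr0.
  by rewrite eSE h_i -cm_d h_i linear0 !subr0.
- by apply: i_mono; rewrite -e_A e_d cm_d -e_A.
- by move=> b; rewrite -e_A e0E subKr.
- by move=> q b; rewrite -e_A eSE -[RHS]addrA -opprD subrK subKr.
Qed.

End DeformationRetract.

(** * Cofree cosimplicial complexes and the resolution *)

Lemma dprod_ext (R : realType) I (V : I -> lmodType R) (x y : dprod V) :
  (forall i, x i = y i) -> x = y.
Proof. exact: functional_extensionality_dep. Qed.

Section DProdMap.
Variables (R : realType) (I J : Type) (V : I -> lmodType R) (W : J -> lmodType R).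
Variables (t : J -> I) (phi : forall j, {linear V (t j) -> W j}).

Definition dprod_map_fun (x : dprod V) : dprod W := fun j => phi j (x (t j)).

Lemma dprod_map_linear : linear dprod_map_fun.
Proof. by move=> a x y; apply: dprod_ext => j; exact: (linearP (phi j)). Qed.

Definition dprod_map : {linear dprod V -> dprod W} := linear_pack dprod_map_linear.

End DProdMap.

Lemma sx_comp_id m n (f : simplex_map m n) : sx_comp f (sx_id m) = f.
Proof. by apply: sx_eqP => i; rewrite !ffunE. Qed.

Lemma sx_id_comp m n (f : simplex_map m n) : sx_comp (sx_id n) f = f.
Proof. by apply: sx_eqP => i; rewrite !ffunE. Qed.

Lemma sx_compA m n p r (h : simplex_map p r) (g : simplex_map n p)
    (f : simplex_map m n) :
  sx_comp h (sx_comp g f) = sx_comp (sx_comp h g) f.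
Proof. by apply: sx_eqP => i; rewrite !ffunE. Qed.

Section Cofree.
Variables (R : realType) (X : cosimplicial R).

Definition under (p : nat) := {n : nat & simplex_map p n}.

Definition under_comp p p' (u : simplex_map p p') (nf : under p') : under p :=
  existT _ (projT1 nf) (sx_comp (projT2 nf) u).

Definition cofree_ob p q : lmodType R :=
  dprod (fun nf : under p => X (projT1 nf) q).

Definition cofree_d p q : {linear cofree_ob p q.+1 -> cofree_ob p q} :=
  dprod_map (t := id) (fun nf => ch_d (X (projT1 nf)) q).

Lemma cofree_dd p q x : cofree_d p q (cofree_d p q.+1 x) = 0.
Proof. by apply: dprod_ext => nf; exact: ch_dd. Qed.

Definition cofree_chain p : chain R := Chain (@cofree_dd p).

Definition cofree_act_lin p p' (u : simplex_map p p') q :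
    {linear cofree_ob p q -> cofree_ob p' q} :=
  dprod_map (t := under_comp u) (fun nf => @idfun (X (projT1 nf) q)).

Lemma cofree_act_d p p' (u : simplex_map p p') q x :
  cofree_act_lin u q (cofree_d p q x) = cofree_d p' q (cofree_act_lin u q.+1 x).
Proof. by []. Qed.

Definition cofree_act p p' (u : simplex_map p p') :
  chain_map (cofree_chain p) (cofree_chain p') :=
  @ChainMap R (cofree_chain p) (cofree_chain p') (cofree_act_lin u) (cofree_act_d u).

Lemma cofree_act_id p q x : cofree_act (sx_id p) q x = x.
Proof.
apply: dprod_ext => -[n f] /=; rewrite /dprod_map_fun /under_comp /=.
by rewrite sx_comp_id.
Qed.

Lemma cofree_act_comp m n p (g : simplex_map n p) (f : simplex_map m n) q x :
  cofree_act (sx_comp g f) q x = cofree_act g q (cofree_act f q x).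
Proof.
apply: dprod_ext => -[k h] /=; rewrite /dprod_map_fun /under_comp /=.
by rewrite sx_compA.
Qed.

(* The right Kan extension of the family (X n)_n along the inclusion of the objects
   of Delta. *)
Definition cofree : cosimplicial R := Cosimplicial cofree_act_id cofree_act_comp.

Definition unit_fun p q (x : X p q) : cofree p q :=
  fun nf => cs_act X (projT2 nf) q x.

Lemma unit_linear p q : linear (@unit_fun p q).
Proof. by move=> a x y; apply: dprod_ext => nf; exact: linearP. Qed.

Definition unit_map p q : {linear X p q -> cofree p q} := linear_pack (@unit_linear p q).

Lemma unit_d p q x : unit_map p q (ch_d (X p) q x) = ch_d (cofree p) q (unit_map p q.+1 x).
Proof. by apply: dprod_ext => nf; exact: cm_d. Qed.

Lemma unit_act p p' (u : simplex_map p p') q x :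
  unit_map p' q (cs_act X u q x) = cs_act cofree u q (unit_map p q x).
Proof. by apply: dprod_ext => nf; rewrite /= /unit_fun /dprod_map_fun /= cs_comp. Qed.

Definition counit_fun p q (x : cofree p q) : X p q := x (existT _ p (sx_id p)).

Lemma counit_linear p q : linear (@counit_fun p q).
Proof. by []. Qed.

Definition counit p q : {linear cofree p q -> X p q} := linear_pack (@counit_linear p q).

Lemma counit_d p q x : counit p q (ch_d (cofree p) q x) = ch_d (X p) q (counit p q.+1 x).
Proof. by []. Qed.

Lemma counit_unit p q x : counit p q (unit_map p q x) = x.
Proof. by rewrite /= /counit_fun /unit_fun cs_id. Qed.

End Cofree.

Section Resolution.
Variables (R : realType) (C : cosimplicial R).

Fixpoint reso s : cosimplicial R := if s is s'.+1 then cofree (reso s') else C.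

(* The alternating sum of the units inserted at all positions, in recursive form. *)
Fixpoint del_fun s p q : reso s p q -> reso s.+1 p q :=
  match s return reso s p q -> reso s.+1 p q with
  | 0 => unit_map C p q
  | s'.+1 => fun x => unit_map (reso s'.+1) p q x -
      ((fun nf => @del_fun s' (projT1 nf) q (x nf)) : cofree (reso s'.+1) p q)
  end.

Lemma del_linear s p q : linear (@del_fun s p q).
Proof.
elim: s p => [|s IHs] p a x y; first exact: linearP.
apply: dprod_ext => nf; pose u := cs_act (reso s.+1) (projT2 nf) q.
rewrite -[LHS]/(u (a *: x + y) - del_fun (a *: x nf + y nf)).
rewrite -[RHS]/(a *: (u x - del_fun (x nf)) + (u y - del_fun (y nf))).
by rewrite linearP IHs scalerBr opprD addrACA.
Qed.

Definition del s p q : {linear reso s p q -> reso s.+1 p q} :=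
  linear_pack (@del_linear s p q).

Lemma delSE s p q (x : reso s.+1 p q) nf :
  del s.+1 p q x nf = unit_map (reso s.+1) p q x nf - del s (projT1 nf) q (x nf).
Proof. by []. Qed.

Lemma del_d s p q x :
  del s p q (ch_d (reso s p) q x) = ch_d (reso s.+1 p) q (del s p q.+1 x).
Proof.
elim: s p x => [|s IHs] p x; first exact: unit_d.
apply: dprod_ext => nf; rewrite delSE unit_d.
by rewrite -[RHS]/(ch_d (reso s.+1 (projT1 nf)) q (del s.+1 p q.+1 x nf)) delSE linearB -IHs.
Qed.

Lemma del_act s p p' (u : simplex_map p p') q x :
  del s p' q (cs_act (reso s) u q x) = cs_act (reso s.+1) u q (del s p q x).
Proof.
case: s x => [|s] x; first exact: unit_act.
by apply: dprod_ext => nf; rewrite delSE unit_act.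
Qed.

(** By naturality of [del] in [p], the unit part of the outer [del] cancels the outer [del] of the
    unit part; what is left is a composite of two [del] one step lower, zero by induction. *)
Lemma del_del s p q x : del s.+1 p q (del s p q x) = 0.
Proof.
elim: s p x => [|s IHs] p x; apply: dprod_ext => nf; rewrite delSE.
  rewrite -[X in X - _]/(cs_act (reso 1) (projT2 nf) q (unit_map C p q x)).
  by rewrite -unit_act; exact: subrr.
rewrite [del s.+1 p q x nf]delSE [X in _ - X]linearB IHs subr0.
rewrite -[X in X - _]/(cs_act (reso s.+2) (projT2 nf) q (del s.+1 p q x)).
by rewrite -del_act; exact: subrr.
Qed.

(** The relation [counit del + del counit = 1]: for fixed [p] the counit contracts the augmented
    resolution. *)
Lemma counit_del s p q (x : reso s.+1 p q) :
  counit (reso s.+1) p q (del s.+1 p q x) = x - del s p q (counit (reso s) p q x).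
Proof.
by rewrite -[LHS]/(del s.+1 p q x (existT _ p (sx_id p))) delSE; congr (_ - _); exact: counit_unit.
Qed.

End Resolution.

(** * The fibrant replacement *)

Section Single.
Variables (R : realType) (I : eqType) (V : I -> lmodType R).

Definition single i (v : V i) : dprod V := fun j =>
  match @eqP _ i j with
  | ReflectT e => eq_rect i (fun j => V j) v j e
  | ReflectF _ => 0
  end.

Lemma single_same i (v : V i) : single v i = v.
Proof. by rewrite /single; case: eqP => // e; rewrite (eq_axiomK e). Qed.

Lemma single_other i (v : V i) j : j != i -> single v j = 0.
Proof. by rewrite /single; case: eqP => // e /eqP[]; exact: esym. Qed.

Lemma single_linear i : linear (@single i).
Proof.
move=> a x y; apply: dprod_ext => j.
rewrite -[RHS]/(a *: single x j + single y j).
have [<-|ji] := eqVneq i j; first by rewrite !single_same.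
by rewrite !single_other 1?eq_sym // scaler0 addr0.
Qed.

End Single.

Section FibrantReplacement.
Variables (R : realType) (C : cosimplicial R).
Local Notation Y := (reso C).

(** The entry [(s, t)] has resolution degree [s] and chain degree [t]; the index [s.+1] leaves out
    the augmentation [C]. All bidegrees share one product, so that no total degree occurs in the
    types and the differential needs no transport. *)
Definition slots p : lmodType R := dprod (fun st : nat * nat => Y st.1.+1 p st.2).

Definition shift p (x : slots p) s t : Y s.+1 p t :=
  match s return Y s.+1 p t with
  | 0 => 0
  | s'.+1 => del C s'.+1 p t (x (s', t))
  end.

(** The total differential of a double complex; [del] commutes with the internal differential, and
    the sign makes the two parts anticommute. *)
Definition D_slots_fun p (x : slots p) : slots p := fun st =>
  (-1) ^+ st.1 *: ch_d (Y st.1.+1 p) st.2 (x (st.1, st.2.+1)) + shift x st.1 st.2.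

Lemma shift_linear p s t a (x y : slots p) :
  shift (a *: x + y) s t = a *: shift x s t + shift y s t.
Proof.
case: s => [|s]; first by rewrite scaler0 addr0.
exact: (linearP (del C s.+1 p t)).
Qed.

Lemma D_slots_linear p : linear (@D_slots_fun p).
Proof.
move=> a x y; apply: dprod_ext => -[s t].
pose d := ch_d (Y s.+1 p) t.
rewrite -[LHS]/((-1) ^+ s *: d (a *: x (s, t.+1) + y (s, t.+1)) + shift (a *: x + y) s t).
rewrite -[RHS]/(a *: ((-1) ^+ s *: d (x (s, t.+1)) + shift x s t)
                + ((-1) ^+ s *: d (y (s, t.+1)) + shift y s t)).
by rewrite [d _]linearP shift_linear !scalerDr !scalerA [_ * a]mulrC addrACA.
Qed.

Definition D_slots p : {linear slots p -> slots p} := linear_pack (@D_slots_linear p).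

Lemma D_slotsE p x s t : D_slots p x (s, t) =
  (-1) ^+ s *: ch_d (Y s.+1 p) t (x (s, t.+1)) + shift x s t.
Proof. by []. Qed.

Lemma del_shift p (x : slots p) s t : del C s.+1 p t (shift x s t) = 0.
Proof. by case: s => [|s]; [exact: linear0|exact: del_del]. Qed.

Lemma D_slots_D_slots p x : D_slots p (D_slots p x) = 0.
Proof.
apply: dprod_ext => -[s t]; rewrite D_slotsE (D_slotsE x s) linearD linearZ_LR ch_dd.
rewrite scaler0 add0r; case: s => [|s]; first by rewrite linear0 scaler0 addr0.
rewrite -[shift (D_slots p x) _ _]/(del C s.+1 p t (D_slots p x (s, t))).
rewrite D_slotsE [X in _ + X]linearD del_shift addr0 linearZ_LR -del_d.
by rewrite exprS mulN1r scaleNr addNr.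
Qed.

Definition slots_act p p' (u : simplex_map p p') : {linear slots p -> slots p'} :=
  dprod_map (t := id) (fun st => cs_act (Y st.1.+1) u st.2).

Lemma D_slots_act p p' (u : simplex_map p p') x :
  D_slots p' (slots_act u x) = slots_act u (D_slots p x).
Proof.
apply: dprod_ext => -[s t]; rewrite -[RHS]/(cs_act (Y s.+1) u t (D_slots p x (s, t))).
rewrite !D_slotsE linearD linearZ_LR cm_d; congr (_ + _).
case: s => [|s]; first by rewrite linear0.
exact: (del_act u (x (s, t))).
Qed.

(* The part of total degree t - s = k; the second condition is the smart truncation. *)
Definition in_slots p (k : nat) (x : slots p) : Prop :=
  (forall s t, t != (k + s)%N -> x (s, t) = 0) /\ (k = 0%N -> D_slots p x = 0).

Lemma in_slots0 p k : @in_slots p k 0.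
Proof. by split=> // _; rewrite linear0. Qed.

Lemma in_slotsP p k (a : R) (x y : slots p) :
  in_slots k x -> in_slots k y -> in_slots k (a *: x + y).
Proof.
move=> [sx dx] [sy dy]; split=> [s t ts|k0]; last first.
  by rewrite linearP dx // dy // scaler0 addr0.
by rewrite -[LHS]/(a *: x (s, t) + y (s, t)) sx // sy // scaler0 addr0.
Qed.

Definition fibrep_sub p k : submod (slots p) := Submod (@in_slots0 p k) (@in_slotsP p k).

Lemma fibrep_sub_D_slots p k x : fibrep_sub p k.+1 x -> fibrep_sub p k (D_slots p x).
Proof.
move=> [sx _]; split=> [s t ts|_]; last exact: D_slots_D_slots.
rewrite D_slotsE sx ?linear0 ?scaler0 ?add0r; last by lia.
case: s ts => [//|s] ts; rewrite -[shift _ _ _]/(del C s.+1 p t (x (s, t))).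
by rewrite sx ?linear0 //; lia.
Qed.

Definition fibrep_d p k : {linear subsp (fibrep_sub p k.+1) -> subsp (fibrep_sub p k)} :=
  restrict (@fibrep_sub_D_slots p k).

Lemma fibrep_dd p k x : fibrep_d p k (fibrep_d p k.+1 x) = 0.
Proof. by apply/val_inj; exact: D_slots_D_slots. Qed.

Definition fibrep_chain p : chain R := Chain (@fibrep_dd p).

Lemma fibrep_sub_act p p' (u : simplex_map p p') k x :
  fibrep_sub p k x -> fibrep_sub p' k (slots_act u x).
Proof.
move=> [sx dx]; split=> [s t ts|k0]; last by rewrite D_slots_act dx // linear0.
by rewrite -[LHS]/(cs_act _ u t (x (s, t))) sx // linear0.
Qed.

Definition fibrep_act_lin p p' (u : simplex_map p p') k :
  {linear subsp (fibrep_sub p k) -> subsp (fibrep_sub p' k)} := restrict (@fibrep_sub_act p p' u k).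

Lemma fibrep_act_d p p' (u : simplex_map p p') k x :
  fibrep_act_lin u k (fibrep_d p k x) = fibrep_d p' k (fibrep_act_lin u k.+1 x).
Proof. by apply/val_inj; exact: esym (D_slots_act u (\val x)). Qed.

Definition fibrep_act p p' (u : simplex_map p p') : chain_map (fibrep_chain p) (fibrep_chain p') :=
  @ChainMap R (fibrep_chain p) (fibrep_chain p') (fibrep_act_lin u) (fibrep_act_d u).

Lemma fibrep_act_id p q x : fibrep_act (sx_id p) q x = x.
Proof. by apply/val_inj/dprod_ext => st; exact: cs_id. Qed.

Lemma fibrep_act_comp m n p (g : simplex_map n p) (f : simplex_map m n) q x :
  fibrep_act (sx_comp g f) q x = fibrep_act g q (fibrep_act f q x).
Proof. by apply/val_inj/dprod_ext => st; exact: cs_comp. Qed.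

Definition fibrep : cosimplicial R := Cosimplicial fibrep_act_id fibrep_act_comp.

Definition slot0 p k (x : C p k) : slots p :=
  single (i := (0, k)%N) (unit_map C p k x).

Lemma slot0_linear p k : linear (@slot0 p k).
Proof. by move=> a x y; rewrite /slot0 linearP single_linear. Qed.

Lemma slot0_same p k x : @slot0 p k x (0, k)%N = unit_map C p k x.
Proof. exact: (single_same (i := (0, k)%N)). Qed.

Lemma slot0_other p k x s t : (s, t) != (0, k)%N -> @slot0 p k x (s, t) = 0.
Proof. exact: single_other. Qed.

Lemma D_slots_slot0 p k x : D_slots p (@slot0 p k.+1 x) = @slot0 p k (ch_d (C p) k x).
Proof.
apply: dprod_ext => -[[|s] t]; rewrite D_slotsE.
  rewrite addr0 expr0 scale1r; have [->|tk] := eqVneq t k.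
    by rewrite !slot0_same unit_d.
  by rewrite !slot0_other ?linear0 // xpair_eqE.
rewrite !(@slot0_other p _ _ s.+1) // linear0 scaler0 add0r /shift.
have [E|N] := eqVneq (s, t) (0, k.+1)%N; last by rewrite slot0_other // linear0.
by case: E => -> ->; rewrite slot0_same; exact: (del_del (s := 0)).
Qed.

Lemma D_slots_slot00 p x : D_slots p (@slot0 p 0 x) = 0.
Proof.
apply: dprod_ext => -[[|s] t]; rewrite D_slotsE.
  by rewrite slot0_other // linear0 scaler0 addr0.
rewrite slot0_other // linear0 scaler0 add0r /shift.
have [E|N] := eqVneq (s, t) (0, 0)%N; last by rewrite slot0_other // linear0.
by case: E => -> ->; rewrite slot0_same; exact: (del_del (s := 0)).
Qed.

Lemma fibrep_sub_slot0 p k (x : C p k) : fibrep_sub p k (slot0 x).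
Proof.
split=> [s t ts|k0]; last by subst k; exact: D_slots_slot00.
by rewrite slot0_other // xpair_eqE; lia.
Qed.

Definition fibrep_unit_lin p k : {linear C p k -> fibrep p k} :=
  corestrict (T := fibrep_sub p k) (f := linear_pack (@slot0_linear p k)) (@fibrep_sub_slot0 p k).

Lemma fibrep_unit_d p k x :
  fibrep_unit_lin p k (ch_d (C p) k x) = ch_d (fibrep p) k (fibrep_unit_lin p k.+1 x).
Proof. by apply/val_inj; exact: esym (D_slots_slot0 x). Qed.

Definition fibrep_unit_chain p : chain_map (C p) (fibrep p) := ChainMap (@fibrep_unit_d p).

Lemma fibrep_unit_nat m n (f : simplex_map m n) q x :
  fibrep_unit_chain n q (cs_act C f q x) = cs_act fibrep f q (fibrep_unit_chain m q x).
Proof.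
apply/val_inj/dprod_ext => -[s t].
rewrite -[LHS]/(slot0 (cs_act C f q x) (s, t)).
rewrite -[RHS]/(cs_act (Y s.+1) f t (slot0 x (s, t))).
have [E|N] := eqVneq (s, t) (0, q)%N; last by rewrite !slot0_other // linear0.
by case: E => -> ->; rewrite !slot0_same unit_act.
Qed.

Definition fibrep_unit : cosimplicial_map C fibrep := CosimplicialMap fibrep_unit_nat.

Lemma fibrep_unit_mono : levelwise_mono fibrep_unit.
Proof.
move=> n q x y /(congr1 val) /= /(congr1 (fun z : slots n => z (0, q)%N)).
rewrite !slot0_same => /(congr1 (counit C n q)).
by rewrite !counit_unit.
Qed.

(** The contraction of the augmented resolution, carried to the total complex. As [slots] leaves out
    the augmentation, a term [unit (counit x)] survives in resolution degree 0. *)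
Definition htp_fun p (x : slots p) : slots p := fun st =>
  counit (Y st.1.+1) p st.2 (x (st.1.+1, st.2)).

Lemma htpE p (x : slots p) s t :
  htp_fun x (s, t) = counit (Y s.+1) p t (x (s.+1, t)).
Proof. by []. Qed.

Lemma htp_D_slots p (x : slots p) s t : htp_fun (D_slots p x) (s, t) =
  x (s, t) - del C s p t (counit (Y s) p t (x (s, t)))
  - (-1) ^+ s *: ch_d (Y s.+1 p) t (htp_fun x (s, t.+1)).
Proof.
rewrite [LHS]htpE D_slotsE linearD counit_del addrC linearZ_LR counit_d.
by rewrite exprS mulN1r scaleNr.
Qed.

Lemma htp_null0 p (x : slots p) t : x (0, t)%N =
  D_slots p (htp_fun x) (0, t)%N + htp_fun (D_slots p x) (0, t)%N
  + unit_map C p t (counit C p t (x (0, t)%N)).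
Proof.
rewrite htp_D_slots D_slotsE addr0 expr0 !scale1r.
rewrite -[unit_map _ _ _ _]/(del C 0 p t (counit C p t (x (0, t)%N))).
by rewrite [X in _ = X + _]addrC !subrK.
Qed.

Lemma htp_nullS p (x : slots p) s t : x (s.+1, t) =
  D_slots p (htp_fun x) (s.+1, t) + htp_fun (D_slots p x) (s.+1, t).
Proof.
rewrite htp_D_slots D_slotsE -[shift _ s.+1 t]/(del C s.+1 p t (counit (Y s.+1) p t (x (s.+1, t)))).
by rewrite addrC addrA !subrK.
Qed.

Lemma htp_supp p k (x : slots p) : fibrep_sub p k x ->
  forall s t, t != (k.+1 + s)%N -> htp_fun x (s, t) = 0.
Proof. by move=> [sx _] s t ts; rewrite htpE sx ?linear0 //; lia. Qed.

Lemma fibrep_sub_htp p k (x : slots p) : fibrep_sub p k x -> fibrep_sub p k.+1 (htp_fun x).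
Proof. by move=> Qx; split=> //; exact: htp_supp. Qed.

Lemma htp_slot0 p k (x : C p k) : htp_fun (slot0 x) = 0.
Proof.
by apply: dprod_ext => -[s t]; rewrite htpE slot0_other // linear0.
Qed.

Lemma htp0 p : htp_fun (0 : slots p) = 0.
Proof. by apply: dprod_ext => -[s t]; rewrite htpE; exact: linear0. Qed.

(** The homotopy formula without its term [htp_fun (D_slots p x)]. By the support condition only one
    entry of resolution degree 0 can be nonzero, so the surviving term is [slot0] of a single
    element. *)
Lemma htp_null p k (x : slots p) : fibrep_sub p k x -> htp_fun (D_slots p x) = 0 ->
  x = slot0 (counit C p k (x (0, k)%N)) + D_slots p (htp_fun x).
Proof.
move=> [sx _] hx; apply: dprod_ext => -[s t].
set y := slot0 _; rewrite -[RHS]/(y (s, t) + D_slots p (htp_fun x) (s, t)).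
rewrite {}/y; case: s => [|s]; last by rewrite slot0_other // add0r [LHS]htp_nullS hx addr0.
rewrite [LHS]htp_null0 hx addr0 addrC; congr (_ + _).
have [->|tk] := eqVneq t k; first by rewrite slot0_same.
rewrite slot0_other ?xpair_eqE // sx ?addn0 //.
by rewrite (linear0 (counit C p t)) linear0.
Qed.

Lemma fibrep_unit_qi : levelwise_quasi_iso fibrep_unit.
Proof.
move=> n; apply/quasi_isoP => -[b|q a b ca db]; have Qb := subsp_mem b.
  exists (counit C n 0 (\val b (0, 0)%N)), (mksub (fibrep_sub_htp Qb)).
  apply/val_inj; apply: (htp_null Qb).
  by rewrite (proj2 Qb) //; exact: htp0.
have {}db : D_slots n (\val b) = slot0 a by exact: (congr1 val db).
exists (counit C n q.+1 (\val b (0, q.+1)%N)), (mksub (fibrep_sub_htp Qb)); split.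
  rewrite -counit_d; have := congr1 (fun z : slots n => counit C n q (z (0, q)%N)) db.
  by rewrite slot0_same counit_unit D_slotsE expr0 scale1r addr0.
by apply/val_inj; apply: (htp_null Qb); rewrite db htp_slot0.
Qed.

End FibrantReplacement.

(** * Injective fibrancy *)

Section Extension.
Variables (R : realType) (C A B : cosimplicial R) (i : cosimplicial_map A B).
Variables (r : forall n q, {linear B n q -> A n q}).
Variables (h : forall n q, {linear B n q -> B n q.+1}).
Hypothesis rh : forall n, is_deformation_retraction (i n) (@r n) (@h n).
Variable f : cosimplicial_map A (fibrep C).
Local Notation Y := (reso C).

Definition slot n q s t : {linear A n q -> Y s.+1 n t} :=
  linear_pack (f := fun a => \val (f n q a) (s, t))
    (fun a x y => congr1 (fun z : fibrep C n q => \val z (s, t)) (linearP (f n q) a x y)).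

(* [ext] is the natural map with adjoint [ext_adj]: r extends f, and the term in h
   makes the extension commute with the total differential. *)
Fixpoint ext s n q t (b : B n q) : Y s.+1 n t := fun mf =>
  let b' := cs_act B (projT2 mf) q b in
  counit (Y s) (projT1 mf) t (slot (projT1 mf) q s t (r (projT1 mf) q b')) +
  counit (Y s) (projT1 mf) t
    (match s return Y s.+1 (projT1 mf) t with
     | 0 => 0
     | s'.+1 => del C s'.+1 (projT1 mf) t (@ext s' (projT1 mf) q.+1 t (h (projT1 mf) q b'))
     end).

Definition ext_shift s n q t (b : B n q) : Y s.+1 n t :=
  match s return Y s.+1 n t with
  | 0 => 0
  | s'.+1 => del C s'.+1 n t (@ext s' n q t b)
  end.

Definition ext_adj s n q t (b : B n q) : Y s n t :=
  counit (Y s) n t (slot n q s t (r n q b))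
  + counit (Y s) n t (@ext_shift s n q.+1 t (h n q b)).

Lemma extE s n q t b (mf : under n) :
  @ext s n q t b mf = @ext_adj s (projT1 mf) q t (cs_act B (projT2 mf) q b).
Proof. by case: s. Qed.

Lemma ext_adj_linear s n q t :
  linear (@ext_shift s n q.+1 t) -> linear (@ext_adj s n q t).
Proof.
move=> sl a x y; exact: (linearP ((counit (Y s) n t \o (slot n q s t \o r n q))
  \+ (counit (Y s) n t \o (linear_pack sl \o h n q)))).
Qed.

Lemma ext_linear_of s q t : (forall n, linear (@ext_shift s n q.+1 t)) ->
  forall n, linear (@ext s n q t).
Proof.
move=> sl n a x y; apply: dprod_ext => mf.
rewrite -[RHS]/(a *: ext s t x mf + ext s t y mf) !extE linearP.
exact: ext_adj_linear.
Qed.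

Lemma ext_linear s n q t : linear (@ext s n q t).
Proof.
elim: s n q => [|s IHs] n q; apply: ext_linear_of => m a x y.
  by rewrite scaler0 addr0.
exact: (linearP (del C s.+1 m t \o linear_pack (IHs m q.+1))).
Qed.

Lemma ext_shift_linear s n q t : linear (@ext_shift s n q t).
Proof.
case: s => [|s] a x y; first by rewrite scaler0 addr0.
exact: (linearP (del C s.+1 n t \o linear_pack (@ext_linear s n q t))).
Qed.

Definition ext_shift_lin s n q t : {linear B n q -> Y s.+1 n t} :=
  linear_pack (@ext_shift_linear s n q t).

Lemma ext_act s n n' (u : simplex_map n n') q t b :
  @ext s n' q t (cs_act B u q b) = cs_act (Y s.+1) u t (ext s t b).
Proof.
apply: dprod_ext => mf; rewrite extE -[RHS]/(ext s t b (under_comp u mf)) extE.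
by rewrite cs_comp.
Qed.

Lemma ext_shift_act s n n' (u : simplex_map n n') q t b :
  @ext_shift s n' q t (cs_act B u q b) = cs_act (Y s.+1) u t (ext_shift s t b).
Proof.
case: s => [|s]; first by rewrite linear0.
by rewrite /ext_shift ext_act del_act.
Qed.

Lemma slot_act s n n' (u : simplex_map n n') q t a :
  slot n' q s t (cs_act A u q a) = cs_act (Y s.+1) u t (slot n q s t a).
Proof. exact: (congr1 (fun z : fibrep C n' q => \val z (s, t)) (csm_nat f u a)). Qed.

Lemma counit_act s n t (y : Y s.+1 n t) (mf : under n) :
  counit (Y s) (projT1 mf) t (cs_act (Y s.+1) (projT2 mf) t y) = y mf.
Proof.
rewrite -[LHS]/(y (existT _ (projT1 mf) (sx_comp (sx_id _) (projT2 mf)))).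
by rewrite sx_id_comp; case: mf.
Qed.

Lemma ext_i s n q t a : @ext s n q t (i n q a) = slot n q s t a.
Proof.
apply: dprod_ext => mf; rewrite extE -csm_nat /ext_adj.
have [rE _ hE _ _] := rh (projT1 mf).
have s0 : ext_shift s t (0 : B (projT1 mf) q.+1) = 0 by exact: linear0 (ext_shift_lin _ _ _ _).
by rewrite rE hE s0 linear0 addr0 slot_act counit_act.
Qed.

Lemma slot_supp s n q t a : t != (q + s)%N -> slot n q s t a = 0.
Proof. exact: (proj1 (subsp_mem (f n q a))). Qed.

Lemma ext_supp s n q t b : t != (q + s)%N -> @ext s n q t b = 0.
Proof.
elim: s n q t b => [|s IHs] n q t b ts; apply: dprod_ext => mf; rewrite extE /ext_adj.
  by rewrite slot_supp // !linear0 addr0.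
rewrite slot_supp // /ext_shift IHs; last by lia.
by rewrite (linear0 (del _ _ _ _)) !linear0 addr0.
Qed.

Lemma slot_shift s n q t a :
  shift (\val (f n q a)) s t = ext_shift s t (i n q a).
Proof. by case: s => [//|s]; rewrite /ext_shift ext_i. Qed.

Lemma slot_d s n q t a : slot n q s t (ch_d (A n) q a) =
  (-1) ^+ s *: ch_d (Y s.+1 n) t (slot n q.+1 s t.+1 a) + ext_shift s t (i n q.+1 a).
Proof.
by rewrite -slot_shift -[LHS]/(\val (f n q _) (s, t)) cm_d.
Qed.

Lemma slot_d0 s n t a :
  (-1) ^+ s *: ch_d (Y s.+1 n) t (slot n 0 s t.+1 a) + ext_shift s t (i n 0 a) = 0.
Proof.
have [_ /(_ erefl) /(congr1 (fun z : slots C n => z (s, t)))] := subsp_mem (f n 0 a).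
by rewrite D_slotsE slot_shift.
Qed.

(** Compatibility with the total differential, entry by entry. The second half says that chain
    degree 0 is sent to cycles, as the smart truncation demands. *)
Let ext_d_spec s :=
  (forall n q t b, (-1) ^+ s *: ch_d (Y s.+1 n) t (@ext s n q.+1 t.+1 b)
     + ext_shift s t b = ext s t (ch_d (B n) q b)) /\
  (forall n t b, (-1) ^+ s *: ch_d (Y s.+1 n) t (@ext s n 0 t.+1 b)
     + ext_shift s t b = 0).

Let ext_shift_d_spec s :=
  (forall n q t b, (-1) ^+ s *: ch_d (Y s.+1 n) t (@ext_shift s n q.+1 t.+1 b)
     = - ext_shift s t (ch_d (B n) q b)) /\
  (forall n t b, (-1) ^+ s *: ch_d (Y s.+1 n) t (@ext_shift s n 0 t.+1 b) = 0).

(** Apply [del] to the equation in resolution degree [s]: the [ext_shift] term dies because [del]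
    squares to zero, and raising [s] changes the sign. *)
Lemma ext_shift_d_step s : ext_d_spec s -> ext_shift_d_spec s.+1.
Proof.
have shS n q t b : @ext_shift s.+1 n q t b = del C s.+1 n t (ext s t b) by [].
have dd n q t b : del C s.+1 n t (@ext_shift s n q t b) = 0.
  by case: (s) b => [|s'] b; [exact: linear0|exact: del_del].
case=> EB E0; split=> [n q t b|n t b]; rewrite !shS -del_d exprS mulN1r scaleNr -linearZ_LR.
  by rewrite -EB [del _ _ _ _ _]linearD dd addr0.
by rewrite -[X in del _ _ _ _ X](addrK (ext_shift s t b)) E0 sub0r [del _ _ _ _ _]linearN dd !oppr0.
Qed.

(** Both sides are compared through their adjoints. Expanding [d h = 1 - i r - h d] inside
    [ext_shift] cancels the term in [b]; the part in [i r] joins the term in [d] and [r] to form the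
    chain-map equation of [f]. *)
Lemma ext_d_step s : ext_shift_d_spec s -> ext_d_spec s.
Proof.
case=> SB S0.
have shB n q t b b' : @ext_shift s n q t (b - b') = ext_shift s t b - ext_shift s t b'.
  exact: (linearB (ext_shift_lin s n q t)).
have adj n q t (x : B n q) (y : Y s.+1 n t) (mf : under n) :
    ((-1) ^+ s *: ch_d (Y s.+1 n) t (ext s t.+1 x) + y) mf =
    counit (Y s) (projT1 mf) t
      ((-1) ^+ s *: ch_d (Y s.+1 (projT1 mf)) t
          (slot _ _ s t.+1 (r _ _ (cs_act B (projT2 mf) q x)))
       + (-1) ^+ s *: ch_d (Y s.+1 (projT1 mf)) t
          (ext_shift s t.+1 (h _ _ (cs_act B (projT2 mf) q x)))
       + cs_act (Y s.+1) (projT2 mf) t y).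
  rewrite -[LHS]/((-1) ^+ s *: ch_d (Y s (projT1 mf)) t (ext s t.+1 x mf) + y mf).
  rewrite extE [RHS]linearD counit_act; congr (_ + _).
  by rewrite /ext_adj linearD scalerDr -!counit_d linearD !linearZ_LR.
split=> [n q t b|n t b]; apply: dprod_ext => mf.
  rewrite adj extE cm_d -ext_shift_act; have [_ rd _ _ hd] := rh (projT1 mf).
  rewrite /ext_adj rd slot_d SB hd !shB !opprB -linearD; congr (counit _ _ _ _).
  by rewrite -!addrA addNr addr0; congr (_ + _); exact: addrC.
rewrite adj -ext_shift_act; have [_ _ _ hd _] := rh (projT1 mf).
have [_ SS] : ext_shift_d_spec s by split.
rewrite -[RHS](linear0 (counit (Y s) (projT1 mf) t)); congr (counit _ _ _ _).
move: (cs_act B _ _ _) => x.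
have -> : (-1) ^+ s *: ch_d (Y s.+1 (projT1 mf)) t (ext_shift s t.+1 (h (projT1 mf) 0 x))
    = - ext_shift s t (ch_d (B (projT1 mf)) 0 (h (projT1 mf) 0 x)) by exact: SB.
by rewrite hd shB opprB -addrA subrK slot_d0.
Qed.

Lemma ext_d s : ext_d_spec s.
Proof.
elim: s => [|s IHs]; apply: ext_d_step; last exact: ext_shift_d_step.
by split=> [n q t b|n t b]; rewrite /ext_shift [ch_d _ _ _]linear0 scaler0 ?oppr0.
Qed.

Definition ext_slots n q (b : B n q) : slots C n := fun st => ext st.1 st.2 b.

Lemma ext_slots_linear n q : linear (@ext_slots n q).
Proof. by move=> a x y; apply: dprod_ext => st; exact: ext_linear. Qed.

Lemma shift_ext_slots n q (b : B n q) s t : shift (ext_slots b) s t = ext_shift s t b.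
Proof. by case: s. Qed.

Lemma D_slots_ext_slots n q (b : B n q.+1) :
  D_slots C n (ext_slots b) = ext_slots (ch_d (B n) q b).
Proof.
by apply: dprod_ext => -[s t]; rewrite D_slotsE shift_ext_slots; exact: (ext_d s).1.
Qed.

Lemma fibrep_sub_ext_slots n q (b : B n q) : fibrep_sub C n q (ext_slots b).
Proof.
split=> [s t ts|q0]; first exact: ext_supp.
subst q; apply: dprod_ext => -[s t]; rewrite D_slotsE shift_ext_slots.
exact: (ext_d s).2.
Qed.

Definition ext_fibrep_lin n q : {linear B n q -> fibrep C n q} :=
  corestrict (T := fibrep_sub C n q) (f := linear_pack (@ext_slots_linear n q))
    (@fibrep_sub_ext_slots n q).

Lemma ext_fibrep_d n q b :
  ext_fibrep_lin n q (ch_d (B n) q b) = ch_d (fibrep C n) q (ext_fibrep_lin n q.+1 b).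
Proof. by apply/val_inj; exact: esym (D_slots_ext_slots b). Qed.

Definition ext_fibrep_chain n : chain_map (B n) (fibrep C n) :=
  @ChainMap R (B n) (fibrep C n) (ext_fibrep_lin n) (@ext_fibrep_d n).

Lemma ext_fibrep_nat m n (u : simplex_map m n) q b :
  ext_fibrep_chain n q (cs_act B u q b) = cs_act (fibrep C) u q (ext_fibrep_chain m q b).
Proof. by apply/val_inj/dprod_ext => -[s t]; exact: ext_act. Qed.

Definition ext_fibrep : cosimplicial_map B (fibrep C) := CosimplicialMap ext_fibrep_nat.

Lemma ext_fibrep_i n q a : ext_fibrep n q (i n q a) = f n q a.
Proof. by apply/val_inj/dprod_ext => -[s t]; exact: ext_i. Qed.

End Extension.

Lemma fibrep_fibrant (R : realType) (C : cosimplicial R) : injectively_fibrant (fibrep C).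
Proof.
move=> A B i im iq f.
have /dependent_choice_fun[r /dependent_choice_fun[h rh]] n :=
  deformation_retraction (im n) (iq n).
by exists (ext_fibrep rh f) => n q x; exact: ext_fibrep_i.
Qed.

(** * Limits of cosimplicial complexes *)

Lemma vertexP n (v : 'I_n.+1) : monotone [ffun i : 'I_1 => v].
Proof. by apply/monotoneP => i j _; rewrite !ffunE. Qed.

Definition vertex n (v : 'I_n.+1) : simplex_map 0 n := SimplexMap (vertexP v).

Lemma edgeP n (v w : 'I_n.+1) : (v <= w)%N ->
  monotone [ffun i : 'I_2 => if i == ord0 then v else w].
Proof.
move=> vw; apply/monotoneP => i j ij; rewrite !ffunE.
case: eqP => [_|i0]; case: eqP => // j0.
by case: i0; apply/val_inj/eqP; rewrite -leqn0 (leq_trans ij) // j0.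
Qed.

Definition edge n (v w : 'I_n.+1) (vw : (v <= w)%N) : simplex_map 1 n :=
  SimplexMap (edgeP vw).

Lemma edge_coface0 n (v w : 'I_n.+1) (vw : (v <= w)%N) :
  sx_comp (edge vw) (coface ord0) = vertex w.
Proof. by apply: sx_eqP => i; rewrite !ffunE. Qed.

Lemma edge_coface1 n (v w : 'I_n.+1) (vw : (v <= w)%N) :
  sx_comp (edge vw) (coface (lift ord0 ord0)) = vertex v.
Proof. by apply: sx_eqP => i; rewrite !ffunE (ord1 i). Qed.

Lemma sx_comp_vertex m n (f : simplex_map m n) v : sx_comp f (vertex v) = vertex (f v).
Proof. by apply: sx_eqP => i; rewrite !ffunE. Qed.

Lemma vertex_id : vertex ord0 = sx_id 0.
Proof. by apply: sx_eqP => i; rewrite !ffunE (ord1 i). Qed.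

Section Limit.
Variables (R : realType) (F : cosimplicial R).

Lemma delta0E q (z : F 0 q) : delta F 0 q z =
  cs_act F (coface ord0) q z - cs_act F (coface (lift ord0 ord0)) q z.
Proof.
rewrite -[LHS]/(delta_fun z) /delta_fun !big_ord_recl big_ord0 addr0.
by rewrite expr0 scale1r expr1 scaleN1r.
Qed.

(** The edge from [v] to [w] factors both vertices through the two cofaces from [[0]] to [[1]], and
    these agree on [z]. *)
Lemma vertex_indep q (z : F 0 q) n (v w : 'I_n.+1) : delta F 0 q z = 0 ->
  cs_act F (vertex v) q z = cs_act F (vertex w) q z.
Proof.
move=> /eqP; rewrite delta0E subr_eq0 => /eqP dz.
wlog vw : v w / (v <= w)%N.
  by move=> H; have [/H//|/ltnW/H] := leqP v w.
by rewrite -(edge_coface0 vw) -(edge_coface1 vw) !cs_comp dz.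
Qed.

Lemma cone_delta (L : chain R) (pr : forall n, chain_map L (F n)) q x :
  is_cone pr -> delta F 0 q (pr 0 q x) = 0.
Proof. by move=> c; rewrite delta0E !c subrr. Qed.

Lemma limit_d q (x : F 0 q.+1) : ker (delta F 0 q.+1) x -> ker (delta F 0 q) (ch_d (F 0) q x).
Proof. by move=> dx; rewrite /= -[LHS]delta_d (dx : delta F 0 q.+1 x = 0) linear0. Qed.

Lemma limit_dd q x : restrict (@limit_d q) (restrict (@limit_d q.+1) x) = 0.
Proof. by apply/val_inj; exact: ch_dd. Qed.

(** A limit over the simplex category is the equalizer of the two cofaces out of level 0, here the
    kernel of their difference. *)
Definition limit_chain : chain R := Chain limit_dd.

Lemma sub_val_linear (V : lmodType R) (S : submod V) : linear (\val : subsp S -> V).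
Proof. by []. Qed.

Definition limit_pr_lin n q : {linear limit_chain q -> F n q} :=
  cs_act F (vertex ord0) q \o linear_pack (@sub_val_linear _ (ker (delta F 0 q))).

Lemma limit_pr_d n q x :
  limit_pr_lin n q (ch_d limit_chain q x) = ch_d (F n) q (limit_pr_lin n q.+1 x).
Proof. exact: cm_d. Qed.

Definition limit_pr n : chain_map limit_chain (F n) :=
  @ChainMap R limit_chain (F n) (limit_pr_lin n) (@limit_pr_d n).

Lemma limit_pr_cone : is_cone limit_pr.
Proof.
move=> m n f q x; rewrite -[LHS]/(cs_act F f q (cs_act F (vertex ord0) q (\val x))).
rewrite -cs_comp sx_comp_vertex; apply: vertex_indep; exact: (subsp_mem x).
Qed.

Section Universal.
Variables (T : chain R) (t : forall n, chain_map T (F n)).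
Hypothesis tc : is_cone t.

Definition limit_lift_lin q : {linear T q -> limit_chain q} :=
  corestrict (T := ker (delta F 0 q)) (f := t 0 q) (fun x => cone_delta x tc).

Lemma limit_lift_d q x :
  limit_lift_lin q (ch_d T q x) = ch_d limit_chain q (limit_lift_lin q.+1 x).
Proof. by apply/val_inj; exact: cm_d. Qed.

Definition limit_lift : chain_map T limit_chain :=
  @ChainMap R T limit_chain limit_lift_lin limit_lift_d.

End Universal.

Lemma limit_is_limit : is_limit limit_pr.
Proof.
split=> [|T t tc]; first exact: limit_pr_cone.
exists (limit_lift tc); split=> [n q x|h' h'E q x].
  exact: tc.
apply/val_inj; rewrite -[RHS]/(t 0 q x) -h'E.
by rewrite -[RHS]/(cs_act F (vertex ord0) q (\val (h' q x))) vertex_id cs_id.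
Qed.

Section AnyLimit.
Variables (L : chain R) (pr : forall n, chain_map L (F n)).
Hypothesis prL : is_limit pr.

Lemma limit_surj q (z : F 0 q) : delta F 0 q z = 0 -> exists x, pr 0 q x = z.
Proof.
move=> dz; have [h [hE _]] := prL.2 _ _ limit_pr_cone.
exists (h q (mksub (S := ker (delta F 0 q)) dz)).
by rewrite hE -[LHS]/(cs_act F (vertex ord0) q z) vertex_id cs_id.
Qed.

(** The composite of [L] with [limit_chain] and back is an endomorphism over the cone, hence the
    identity; its first factor is determined by [pr 0]. *)
Lemma limit_inj q : injective (pr 0 q).
Proof.
have [h [hE _]] := prL.2 _ _ limit_pr_cone.
have [h1 [_ h1U]] := prL.2 _ _ prL.1.
pose k := limit_lift prL.1.
pose id_map := @ChainMap R L L (fun q => idfun) (fun q x => erefl).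
pose hk := @ChainMap R L L (fun q => h q \o k q)
  (fun q x => etrans (congr1 (h q) (cm_d k x)) (cm_d h (k q.+1 x))).
have hkE x : hk q x = x.
  rewrite (h1U hk) => [|n q' y]; first by rewrite -(h1U id_map).
  by rewrite hE; exact: prL.1.
move=> x y xy; rewrite -[x]hkE -[y]hkE /=; congr (h q _).
exact/val_inj.
Qed.

End AnyLimit.

End Limit.

(** * Total complexes *)

Section TotElements.
Variables (R : realType) (C : cosimplicial R).

(** The smart truncation makes degree 0 a subspace of a subspace; forgetting the nesting lets all
    degrees be treated alike inside [bigraded]. *)
Definition tot_val k : tot C k -> bigraded C :=
  match k return tot C k -> bigraded C with
  | 0 => fun x => \val (\val x)
  | _.+1 => fun x => \val x
  end.

Lemma tot_val_linear k : linear (@tot_val k).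
Proof. by case: k. Qed.

Lemma tot_val_inj k : injective (@tot_val k).
Proof. by case: k => [|k] x y xy; [do 2 apply: val_inj|apply: val_inj]. Qed.

Lemma tot_val_line k (x : tot C k) : line C k (tot_val x).
Proof. by case: k x => [|k] x; [exact: (subsp_mem (\val x))|exact: (subsp_mem x)]. Qed.

Lemma tot_val_d k (x : tot C k.+1) : tot_val (ch_d (tot C) k x) = D C (tot_val x).
Proof. by case: k x. Qed.

Lemma tot_val_cycle k (x : tot C k) : is_cycle x -> D C (tot_val x) = 0.
Proof.
case: k x => [x _|k x dx]; first exact: (congr1 val (subsp_mem x)).
by rewrite -tot_val_d dx; case: (k).
Qed.

Lemma tot_val_surj (k : nat) (x : bigraded C) : line C k x -> (k = 0%N -> D C x = 0) ->
  exists y : tot C k, tot_val y = x.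
Proof.
case: k => [|k] lx dx; last by exists (mksub (S := line C k.+1) lx).
have Dx : ker (zch_d (totZ C) 0) (mksub (S := line C 0) lx).
  by apply/val_inj; exact: dx.
by exists (mksub Dx).
Qed.

Section ToTot.
Variables (X : chain R) (phi : forall k, {linear X k -> bigraded C}).
Hypothesis phi_line : forall (k : nat) x, line C k (phi k x).
Hypothesis phi_d : forall k x, phi k (ch_d X k x) = D C (phi k.+1 x).
Hypothesis phi_d0 : forall x, D C (phi 0 x) = 0.

Lemma to_tot_ker x :
  ker (zch_d (totZ C) 0) (corestrict (T := line C 0) (f := phi 0) (phi_line (k := 0)) x).
Proof. by apply/val_inj; exact: phi_d0. Qed.

Definition to_tot_lin k : {linear X k -> tot C k} :=
  match k return {linear X k -> tot C k} with
  | 0 => corestrict (T := ker (zch_d (totZ C) 0)) to_tot_ker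
  | k'.+1 => corestrict (T := line C k'.+1) (f := phi k'.+1) (phi_line (k := k'.+1))
  end.

Lemma tot_val_to_tot k x : tot_val (to_tot_lin k x) = phi k x.
Proof. by case: k x. Qed.

Lemma to_tot_d k x : to_tot_lin k (ch_d X k x) = ch_d (tot C) k (to_tot_lin k.+1 x).
Proof. by apply: tot_val_inj; rewrite tot_val_d !tot_val_to_tot. Qed.

Definition to_tot : chain_map X (tot C) := @ChainMap R X (tot C) to_tot_lin to_tot_d.

End ToTot.

Lemma DSE (x : bigraded C) p q : D C x (p.+1, q) =
  Nd C p.+1 q (x (p.+1, q.+1)) - (-1) ^ (q%:Z - p%:Z) *: Ndelta C p q (x (p, q)).
Proof. by []. Qed.

Lemma D0E (x : bigraded C) q : D C x (0, q)%N = Nd C 0 q (x (0, q.+1)%N).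
Proof. by []. Qed.

(** Equations for [D] are solved in [bigraded] without regard to total degree; this projection then
    cuts out a homogeneous solution. *)
Definition proj_line (k : int) (x : bigraded C) : bigraded C :=
  fun pq => if pq.2%:Z - pq.1%:Z == k then x pq else 0.

Lemma proj_line_mem k x : line C k (proj_line k x).
Proof. by move=> p q /negPf kpq; rewrite /proj_line kpq. Qed.

Lemma proj_line_id k x : line C k x -> proj_line k x = x.
Proof.
move=> lx; apply: dprod_ext => -[p q]; rewrite /proj_line /=.
by case: ifPn => // /lx ->.
Qed.

Lemma proj_lineE k x p q : proj_line k x (p, q) =
  if q%:Z - p%:Z == k then x (p, q) else 0.
Proof. by []. Qed.

Lemma proj_line_D k x : D C (proj_line k x) = proj_line (k - 1) (D C x).
Proof.
apply: dprod_ext => -[[|p] q]; rewrite proj_lineE.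
  rewrite !D0E proj_lineE.
  have -> : (q.+1%:Z - 0%:Z == k) = (q%:Z - 0%:Z == k - 1) by lia.
  by case: ifP => // _; rewrite linear0.
rewrite !DSE !proj_lineE.
have -> : (q.+1%:Z - p.+1%:Z == k) = (q%:Z - p.+1%:Z == k - 1) by lia.
have -> : (q%:Z - p%:Z == k) = (q%:Z - p.+1%:Z == k - 1) by lia.
by case: ifP => // _; rewrite !linear0 addr0.
Qed.

Lemma proj_lineD k x y : proj_line k (x + y) = proj_line k x + proj_line k y.
Proof.
apply: dprod_ext => -[p q]; rewrite -[RHS]/(proj_line k x (p, q) + proj_line k y (p, q)).
by rewrite !proj_lineE; case: ifP => // _; rewrite addr0.
Qed.

End TotElements.

Lemma cosimplicial_map_delta (R : realType) (A B : cosimplicial R)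
    (f : cosimplicial_map A B) p q x :
  f p.+1 q (delta A p q x) = delta B p q (f p q x).
Proof.
rewrite -[LHS]/(f p.+1 q (delta_fun x)) -[RHS]/(delta_fun (f p q x)) /delta_fun linear_sum.
by apply: eq_bigr => i _; rewrite linearZ_LR csm_nat.
Qed.

Section TotMap.
Variables (R : realType) (A B : cosimplicial R) (f : cosimplicial_map A B).

Lemma normalized_map p q (x : A p q) : normalized A p q x -> normalized B p q (f p q x).
Proof. by case: p x => // p x Nx i; rewrite -csm_nat Nx linear0. Qed.

Definition Nmap p q : {linear Ncx A p q -> Ncx B p q} := restrict (@normalized_map p q).

Lemma Nmap_Nd p q x : Nmap p q (Nd A p q x) = Nd B p q (Nmap p q.+1 x).
Proof. by apply/val_inj; exact: cm_d. Qed.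

Lemma Nmap_Ndelta p q x : Nmap p.+1 q (Ndelta A p q x) = Ndelta B p q (Nmap p q x).
Proof.
by apply/val_inj; exact: cosimplicial_map_delta.
Qed.

Definition bigraded_map : {linear bigraded A -> bigraded B} :=
  dprod_map (t := id) (fun pq => Nmap pq.1 pq.2).

Lemma bigraded_mapE x p q : bigraded_map x (p, q) = Nmap p q (x (p, q)).
Proof. by []. Qed.

Lemma bigraded_map_line k x : line A k x -> line B k (bigraded_map x).
Proof. by move=> lx p q pq; rewrite bigraded_mapE lx // linear0. Qed.

Lemma bigraded_map_D x : bigraded_map (D A x) = D B (bigraded_map x).
Proof.
apply: dprod_ext => -[[|p] q]; rewrite bigraded_mapE; first exact: Nmap_Nd.
by rewrite !DSE [LHS]linearB linearZ_LR Nmap_Nd Nmap_Ndelta.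
Qed.

Lemma proj_line_map k x : bigraded_map (proj_line k x) = proj_line k (bigraded_map x).
Proof.
apply: dprod_ext => -[p q]; rewrite bigraded_mapE !proj_lineE.
by case: ifP => // _; rewrite linear0.
Qed.

Definition tot_map_phi k : {linear tot A k -> bigraded B} :=
  bigraded_map \o linear_pack (@tot_val_linear R A k).

Lemma tot_map_line (k : nat) x : line B k (tot_map_phi k x).
Proof. by apply: bigraded_map_line; exact: tot_val_line. Qed.

Lemma tot_map_d k x : tot_map_phi k (ch_d (tot A) k x) = D B (tot_map_phi k.+1 x).
Proof.
rewrite -[LHS]/(bigraded_map (tot_val (ch_d (tot A) k x))) tot_val_d.
exact: bigraded_map_D.
Qed.

Lemma tot_map_d0 x : D B (tot_map_phi 0 x) = 0.
Proof.
rewrite -[LHS]/(D B (bigraded_map (tot_val x))) -bigraded_map_D tot_val_cycle //.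
exact: linear0.
Qed.

Definition tot_map : chain_map (tot A) (tot B) := to_tot tot_map_line tot_map_d tot_map_d0.

Lemma tot_val_map k x : tot_val (tot_map k x) = bigraded_map (tot_val x).
Proof. exact: tot_val_to_tot. Qed.

End TotMap.

(** * Invariance of the total complex *)

Section NormalizedProjection.
Variables (R : realType) (C : cosimplicial R).

(* The composite of the 1 - d^(j+1) s^j: once the factors up to j have been applied,
   s^0, ..., s^j vanish. *)
Fixpoint nproj_upto p q n : {linear C p.+1 q -> C p.+1 q} :=
  if n is j.+1 then
    (idfun \- (cs_act C (coface (inord j.+1)) q \o cs_act C (codegen (inord j : 'I_p.+1)) q))
    \o nproj_upto p q j
  else idfun.

Lemma nproj_uptoS p q j x : nproj_upto p q j.+1 x = nproj_upto p q j x -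
  cs_act C (coface (inord j.+1)) q
    (cs_act C (codegen (inord j : 'I_p.+1)) q (nproj_upto p q j x)).
Proof. by []. Qed.

(** The cosimplicial identities behind [nproj_upto]: a later factor [1 - d^(j+1) s^j] preserves the
    vanishing under an earlier [s^i]. *)
Lemma codegen_coface_codegen p (i j : 'I_p.+1) (k : 'I_p.+2) :
  (i < j)%N -> k = j.+1 :> nat ->
  exists w : simplex_map p p, sx_comp (codegen i) (sx_comp (coface k) (codegen j)) =
    sx_comp w (codegen i).
Proof.
case: p i j k => [|p] i j k ij kj.
  by move: ij; rewrite (ord1 i) (ord1 j).
have ltj := ltn_ord j; have jP : (j.-1 < p.+1)%N by lia.
exists (sx_comp (coface j) (codegen (Ordinal jP))).
by apply: sx_eqP => m; rewrite !ffunE /= kj /bump /unbump; lia.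
Qed.

Lemma nproj_upto_normal p q n x (i : 'I_p.+1) : (i < n <= p.+1)%N ->
  cs_act C (codegen i) q (nproj_upto p q n x) = 0.
Proof.
elim: n => [|j IHj] /andP[ij jp]; first by [].
have jE : (inord j : 'I_p.+1) = j :> nat by rewrite inordK //; lia.
have j1E : (inord j.+1 : 'I_p.+2) = j.+1 :> nat by rewrite inordK //; lia.
rewrite nproj_uptoS linearB; have [ij'|ji] := ltnP i j.
  have ijE : (i < (inord j : 'I_p.+1))%N by rewrite jE.
  rewrite -!cs_comp; have [|w ->] := codegen_coface_codegen (k := inord j.+1) ijE.
    by rewrite jE j1E.
  rewrite cs_comp IHj; last by lia.
  by rewrite linear0 subrr.
have -> : i = inord j by apply/val_inj => /=; rewrite jE; lia.
rewrite -[X in _ - X]cs_comp codegen_coface_id ?cs_id ?subrr //.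
by rewrite jE j1E eqxx orbT.
Qed.

Lemma nproj_upto_id p q n x : normalized C p.+1 q x -> nproj_upto p q n x = x.
Proof.
move=> Nx; elim: n => [//|n IHn].
by rewrite nproj_uptoS IHn (Nx (inord n)) linear0 subr0.
Qed.

Lemma nproj_upto_d p q n x :
  nproj_upto p q n (ch_d (C p.+1) q x) = ch_d (C p.+1) q (nproj_upto p q.+1 n x).
Proof.
elim: n => [//|n IHn].
by rewrite !nproj_uptoS IHn !cm_d [RHS]linearB.
Qed.

Definition nproj p q : {linear C p q -> C p q} :=
  match p return {linear C p q -> C p q} with
  | 0 => idfun
  | p'.+1 => nproj_upto p' q p'.+1
  end.

Lemma nproj_normal p q x : normalized C p q (nproj p q x).
Proof.
case: p x => [//|p] x i; apply: nproj_upto_normal.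
by rewrite ltn_ord leqnn.
Qed.

Lemma nproj_id p q x : normalized C p q x -> nproj p q x = x.
Proof. by case: p x => [//|p] x Nx; exact: nproj_upto_id. Qed.

Lemma nproj_d p q x : nproj p q (ch_d (C p) q x) = ch_d (C p) q (nproj p q.+1 x).
Proof. by case: p x => [//|p] x; exact: nproj_upto_d. Qed.

Definition normalized_column p : chain R := Chain (@Nd_Nd R C p).

End NormalizedProjection.

Section NormalizedMap.
Variables (R : realType) (A B : cosimplicial R) (f : cosimplicial_map A B).

Lemma nproj_map p q x : f p q (nproj A p q x) = nproj B p q (f p q x).
Proof.
case: p x => [//|p] x.
suff H n : f p.+1 q (nproj_upto A p q n x) = nproj_upto B p q n (f p.+1 q x) by exact: H.
by elim: n => [//|n IHn]; rewrite !nproj_uptoS linearB !csm_nat IHn.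
Qed.

Definition column_map p : chain_map (normalized_column A p) (normalized_column B p) :=
  @ChainMap R (normalized_column A p) (normalized_column B p) (@Nmap R A B f p)
    (@Nmap_Nd R A B f p).

(* The normalized columns are natural retracts of the columns. *)
Lemma column_map_qi p : quasi_iso (f p) -> quasi_iso (column_map p).
Proof.
move=> /quasi_isoP fL; apply/quasi_isoP => -[b|q a b ca db].
  have [a' [b' bE]] := fL 0 (\val b).
  exists (mksub (nproj_normal a')), (mksub (nproj_normal b')).
  apply/val_inj; rewrite /= nproj_map -nproj_d -linearD -bE nproj_id //.
  exact: (subsp_mem b).
have cva : is_cycle (\val a).
  by case: q a {b db} ca => [//|q] a ca; exact: (congr1 val ca).
have [a' [b' [aE bE]]] := fL q.+1 (\val a) (\val b) cva (congr1 val db).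
exists (mksub (nproj_normal a')), (mksub (nproj_normal b')); split.
  by apply/val_inj; rewrite /= -nproj_d aE nproj_id //; exact: (subsp_mem a).
apply/val_inj; rewrite /= nproj_map -nproj_d -linearD -bE nproj_id //.
exact: (subsp_mem b).
Qed.

(** * Solving the total complex column by column *)

Section ColumnLift.
Hypothesis f_qi : levelwise_quasi_iso f.

Definition compatible p (alpha : forall q, Ncx A p q) (beta : forall q, Ncx B p q) :=
  (forall q, is_cycle (X := normalized_column A p) (alpha q)) /\
  (forall q, Nd B p q (beta q.+1) = Nmap f p q (alpha q)).

Definition column_solution p (alpha a' : forall q, Ncx A p q)
    (beta b' : forall q, Ncx B p q) :=
  (forall q, Nd A p q (a' q.+1) = alpha q) /\
  (forall q, beta q = Nmap f p q (a' q) + Nd B p q (b' q.+1)).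

Lemma column_lift p alpha beta : @compatible p alpha beta ->
  exists ab : (forall q, Ncx A p q) * (forall q, Ncx B p q),
    column_solution alpha ab.1 beta ab.2.
Proof.
move=> [ca db]; have /quasi_isoP L := column_map_qi (@f_qi p).
have /dependent_choice_fun[s sE] q : exists ab : Ncx A p q * Ncx B p q.+1,
    match q return Ncx A p q -> Prop with
    | 0 => fun=> True
    | q'.+1 => fun a => Nd A p q' a = alpha q'
    end ab.1 /\ beta q = Nmap f p q ab.1 + Nd B p q ab.2.
  case: q => [|q]; first by have [a' [b' bE]] := L 0 (beta 0%N); exists (a', b').
  by have [a' [b' [aE bE]]] := L q.+1 (alpha q) (beta q.+1) (ca q) (db q); exists (a', b').
exists (fun q => (s q).1, fun q => if q is q'.+1 then (s q').2 else 0).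
by split=> q; [exact: (sE q.+1).1|exact: (sE q).2].
Qed.

(** One solution function, total in its data, so that the recursion over the columns can be defined
    before compatibility is proved. *)
Lemma column_solver : exists sol : forall p, (forall q, Ncx A p q) -> (forall q, Ncx B p q) ->
    (forall q, Ncx A p q) * (forall q, Ncx B p q),
  forall p alpha beta, compatible alpha beta ->
    column_solution alpha (sol p alpha beta).1 beta (sol p alpha beta).2.
Proof.
have H (i : {p : nat & ((forall q, Ncx A p q) * (forall q, Ncx B p q))%type}) :
    exists ab : (forall q, Ncx A (projT1 i) q) * (forall q, Ncx B (projT1 i) q),
    compatible (projT2 i).1 (projT2 i).2 ->
    column_solution (projT2 i).1 ab.1 (projT2 i).2 ab.2.
  have [/column_lift[ab abE]|N] := pselect (compatible (projT2 i).1 (projT2 i).2).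
    by exists ab.
  (* Default value on incompatible data, about which nothing is claimed. *)
  by exists (fun=> 0, fun=> 0).
have [s sE] := dependent_choice_fun H.
exists (fun p alpha beta => s (existT _ p (alpha, beta))) => p alpha beta.
exact: (sE (existT _ p (alpha, beta))).
Qed.

Local Notation sgn p q := ((-1) ^ (q%:Z - p%:Z) : R).

Lemma sgnS (p q : nat) : sgn p q.+1 = - sgn p q.
Proof.
have -> : q.+1%:Z - p%:Z = 1 + (q%:Z - p%:Z) by lia.
by rewrite expfzDr ?oppr_eq0 ?oner_eq0 // expr1z mulN1r.
Qed.

(** The part of [D] that changes the column only raises [p], so the columns are solved in increasing
    order, the [delta] of one solution entering the data of the next. Infinitely many nonzero
    columns are harmless in a product. *)
Lemma bigraded_lift (a : bigraded A) (b : bigraded B) :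
  D A a = 0 -> D B b = bigraded_map f a ->
  exists a' b', D A a' = a /\ b = bigraded_map f a' + D B b'.
Proof.
move=> Da Db; have [sol solE] := column_solver.
pose next p (ab : (forall q, Ncx A p q) * (forall q, Ncx B p q)) :=
  (fun q => a (p.+1, q) + sgn p q *: Ndelta A p q (ab.1 q),
   fun q => b (p.+1, q) + sgn p q *: Ndelta B p q (ab.2 q)).
pose S := fix S p : (forall q, Ncx A p q) * (forall q, Ncx B p q) :=
  match p return (forall q, Ncx A p q) * (forall q, Ncx B p q) with
  | 0 => sol 0%N (fun q => a (0, q)%N) (fun q => b (0, q)%N)
  | p'.+1 => sol p'.+1 (next p' (S p')).1 (next p' (S p')).2
  end.
pose data p : (forall q, Ncx A p q) * (forall q, Ncx B p q) :=
  match p return (forall q, Ncx A p q) * (forall q, Ncx B p q) with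
  | 0 => (fun q => a (0, q)%N, fun q => b (0, q)%N)
  | p'.+1 => next p' (S p')
  end.
have SE p : S p = sol p (data p).1 (data p).2 by case: p.
(* The corrections made to the data are themselves values of [delta], hence invisible to the next
   [delta]. *)
have delta_data p q : Ndelta A p q ((data p).1 q) = Ndelta A p q (a (p, q)) /\
    Ndelta B p q ((data p).2 q) = Ndelta B p q (b (p, q)).
  case: p => [//|p]; split.
    rewrite -[LHS]/(Ndelta A p.+1 q (a (p.+1, q) + sgn p q *: Ndelta A p q ((S p).1 q))).
    by rewrite linearD linearZ_LR Ndelta_Ndelta scaler0 addr0.
  rewrite -[LHS]/(Ndelta B p.+1 q (b (p.+1, q) + sgn p q *: Ndelta B p q ((S p).2 q))).
  by rewrite linearD linearZ_LR Ndelta_Ndelta scaler0 addr0.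
have Dax p q := congr1 (fun z : bigraded A => z (p, q)) Da.
have Dbx p q := congr1 (fun z : bigraded B => z (p, q)) Db.
(* The equations [D a = 0] and [D b = f a] in column [p.+1], together with the solution in column
   [p], say that the corrected data are compatible again. *)
have solS p : compatible (data p).1 (data p).2.
  elim: p => [|p IHp].
    by split=> [[//|q]|q]; [exact: (Dax 0%N q)|exact: (Dbx 0%N q)].
  have := solE _ _ _ IHp; rewrite -SE => -[aS bS]; split=> [[//|q]|q].
    apply: etrans (Dax p.+1 q); rewrite DSE.
    rewrite -[LHS]/(Nd A p.+1 q (a (p.+1, q.+1) + sgn p q.+1 *: Ndelta A p q.+1 ((S p).1 q.+1))).
    rewrite linearD linearZ_LR Nd_Ndelta aS (delta_data p q).1 sgnS.
    by rewrite scaleNr.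
  rewrite -[LHS]/(Nd B p.+1 q (b (p.+1, q.+1) + sgn p q.+1 *: Ndelta B p q.+1 ((S p).2 q.+1))).
  rewrite -[RHS]/(Nmap f p.+1 q (a (p.+1, q) + sgn p q *: Ndelta A p q ((S p).1 q))).
  rewrite linearD linearZ_LR Nd_Ndelta.
  have -> : Nd B p q ((S p).2 q.+1) = (data p).2 q - Nmap f p q ((S p).1 q).
    by rewrite bS [_ + Nd _ _ _ _]addrC addrK.
  rewrite [X in _ *: X]linearB (delta_data p q).2 -Nmap_Ndelta sgnS scaleNr scalerBr opprB addrCA.
  have Dbpq := Dbx p.+1 q; rewrite DSE bigraded_mapE in Dbpq.
  by rewrite [X in _ + X = _]Dbpq addrC [RHS]linearD linearZ_LR.
have solution p : column_solution (data p).1 (S p).1 (data p).2 (S p).2.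
  by rewrite SE; exact: solE.
exists (fun pq => (S pq.1).1 pq.2), (fun pq => (S pq.1).2 pq.2); split.
  apply: dprod_ext => -[[|p] q]; first exact: (solution 0%N).1.
  by rewrite DSE (solution p.+1).1 addrK.
apply: dprod_ext => -[[|p] q]; first exact: (solution 0%N).2.
rewrite -[RHS]/(Nmap f p.+1 q ((S p.+1).1 q) + (Nd B p.+1 q ((S p.+1).2 q.+1)
  - sgn p q *: Ndelta B p q ((S p).2 q))).
by rewrite addrA -(solution p.+1).2 addrK.
Qed.

Lemma tot_map_qi : quasi_iso (tot_map f).
Proof.
have lin (D0 : cosimplicial R) k (x y : tot D0 k) : tot_val (x + y) = tot_val x + tot_val y.
  exact: (linearD (linear_pack (@tot_val_linear R D0 k))).
apply/quasi_isoP => -[b|q a b ca db].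
  have Db : D B (tot_val b) = bigraded_map f 0 by rewrite linear0 tot_val_cycle.
  have [a' [b' [Da bE]]] := bigraded_lift (linear0 (D A)) Db.
  have [|x xE] := @tot_val_surj R A 0 _ (@proj_line_mem R A 0 a').
    by move=> _; rewrite proj_line_D Da; apply: dprod_ext => pq; rewrite /proj_line; case: ifP.
  have [//|y yE] := @tot_val_surj R B 1 _ (@proj_line_mem R B 1 b').
  exists x, y; apply: tot_val_inj.
  rewrite lin tot_val_map tot_val_d xE yE proj_line_map proj_line_D -proj_lineD -bE.
  by rewrite proj_line_id //; exact: tot_val_line.
have Db : D B (tot_val b) = bigraded_map f (tot_val a).
  by rewrite -tot_val_d db tot_val_map.
have [a' [b' [Da bE]]] := bigraded_lift (tot_val_cycle ca) Db.
have [//|x xE] := @tot_val_surj R A q.+1 _ (@proj_line_mem R A q.+1 a').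
have [//|y yE] := @tot_val_surj R B q.+2 _ (@proj_line_mem R B q.+2 b').
have qE k : k.+1%:Z - 1 = k by lia.
exists x, y; split; apply: tot_val_inj.
  by rewrite tot_val_d xE proj_line_D Da qE proj_line_id //; exact: tot_val_line.
rewrite lin tot_val_map tot_val_d xE yE proj_line_map proj_line_D qE -proj_lineD -bE.
by rewrite proj_line_id //; exact: tot_val_line.
Qed.

End ColumnLift.

End NormalizedMap.

(** * The cone contraction of cofree objects *)

Definition cone_fun p n (f : simplex_map p n) : {ffun 'I_p.+2 -> 'I_n.+1} :=
  [ffun i => if unlift ord0 i is Some j then f j else ord0].

Lemma cone_monotone p n (f : simplex_map p n) : monotone (cone_fun f).
Proof.
apply/monotoneP => i j; rewrite !ffunE.
case: unliftP => [i'|] ->; case: unliftP => [j'|] -> //=.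
by rewrite /bump /= !add1n ltnS; apply: (monotoneP _ (sx_monotone f)).
Qed.

(* The join of f with a new initial vertex, sent to the vertex 0. *)
Definition cone p n (f : simplex_map p n) : simplex_map p.+1 n :=
  SimplexMap (cone_monotone f).

Lemma cone_lift p n (f : simplex_map p n) j : cone f (lift ord0 j) = f j.
Proof. by rewrite ffunE liftK. Qed.

Lemma cone_ord0 p n (f : simplex_map p n) : cone f ord0 = ord0.
Proof. by rewrite ffunE unlift_none. Qed.

Lemma cone_coface0 p n (f : simplex_map p n) : sx_comp (cone f) (coface ord0) = f.
Proof. by apply: sx_eqP => i; rewrite ffunE [coface _ _]ffunE cone_lift. Qed.

Lemma cone_coface_lift p n (f : simplex_map p.+1 n) (i : 'I_p.+2) :
  sx_comp (cone f) (coface (lift ord0 i)) = cone (sx_comp f (coface i)).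
Proof.
apply: sx_eqP => j; rewrite ffunE; congr (val _).
case: (unliftP ord0 j) => [j'|] ->.
  rewrite [RHS]cone_lift [RHS]ffunE -[RHS](cone_lift f); congr (cone f _).
  by apply/val_inj; rewrite !ffunE /= /bump /=; lia.
rewrite [RHS]cone_ord0 -[RHS](cone_ord0 f); congr (cone f _).
by apply/val_inj; rewrite !ffunE /= /bump /=; lia.
Qed.

Lemma cone_coface1 n (f : simplex_map 0 n) :
  sx_comp (cone f) (coface (lift ord0 ord0)) = vertex ord0.
Proof.
apply: sx_eqP => j; rewrite ffunE [vertex _ _]ffunE; congr (val _).
rewrite -[RHS](cone_ord0 f); congr (cone f _).
by apply/val_inj; rewrite (ord1 j) !ffunE /= /bump /=.
Qed.

Lemma cone_codegen p n (f : simplex_map p n) (i : 'I_p.+1) :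
  sx_comp (cone f) (codegen (lift ord0 i)) = cone (sx_comp f (codegen i)).
Proof.
apply: sx_eqP => j; rewrite ffunE; congr (val _).
case: (unliftP ord0 j) => [j'|] ->.
  rewrite [RHS]cone_lift [RHS]ffunE -[RHS](cone_lift f); congr (cone f _).
  by apply/val_inj; rewrite !ffunE /= /bump /unbump /=; lia.
rewrite [RHS]cone_ord0 -[RHS](cone_ord0 f); congr (cone f _).
by apply/val_inj; rewrite !ffunE /= /bump /unbump /=; lia.
Qed.

Lemma dprod_sumE (R : realType) I (V : I -> lmodType R) n (F : 'I_n -> dprod V) i :
  (\sum_(j < n) F j) i = \sum_(j < n) F j i.
Proof.
exact: (big_morph (fun x : dprod V => x i) (id1 := 0) (op1 := +%R) (fun x y => erefl) erefl).
Qed.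

Section CofreeContraction.
Variables (R : realType) (X : cosimplicial R).
Local Notation G := (cofree X).

Definition under_cone p (nf : under p) : under p.+1 :=
  existT _ (projT1 nf) (cone (projT2 nf)).

(** The extra codegeneracy of a cofree object, given by precomposition with [cone]. *)
Definition sigma p q : {linear G p.+1 q -> G p q} :=
  dprod_map (t := @under_cone p) (fun nf => @idfun (X (projT1 nf) q)).

Definition under_vertex (nf : under 0) : under 0 :=
  existT _ (projT1 nf) (vertex ord0).

(** The projection of level 0 onto the limit of the cofree object: [delta_const0] and [const0_id]
    show that it maps onto the kernel of [delta]. *)
Definition const0 q : {linear G 0 q -> G 0 q} :=
  dprod_map (t := under_vertex) (fun nf => @idfun (X (projT1 nf) q)).

(** Coface 0 removes the cone vertex and yields the identity; the other cofaces commute with [cone]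
    and cancel, their index and hence their sign being shifted by one. *)
Lemma sigma_delta p q (x : G p.+1 q) :
  sigma p.+1 q (delta G p.+1 q x) + delta G p q (sigma p q x) = x.
Proof.
apply: dprod_ext => nf.
rewrite -[LHS]/(delta_fun x (under_cone nf) + delta_fun (sigma p q x) nf).
rewrite /delta_fun !dprod_sumE big_ord_recl -addrA -big_split big1 ?addr0 => [|i _].
  rewrite expr0 scale1r.
  rewrite -[LHS]/(x (existT _ (projT1 nf) (sx_comp (cone (projT2 nf)) (coface ord0)))).
  by rewrite cone_coface0; case: nf.
rewrite -[LHS]/((-1) ^+ i.+1 *:
  x (existT _ (projT1 nf) (sx_comp (cone (projT2 nf)) (coface (lift ord0 i))))
  + (-1) ^+ i *: x (existT _ (projT1 nf) (cone (sx_comp (projT2 nf) (coface i))))).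
rewrite cone_coface_lift exprS mulN1r scaleNr.
exact: addNr.
Qed.

Lemma sigma_delta0 q (x : G 0 q) : sigma 0 q (delta G 0 q x) + const0 q x = x.
Proof.
rewrite delta0E; apply: dprod_ext => nf.
rewrite -[LHS]/(x (existT _ (projT1 nf) (sx_comp (cone (projT2 nf)) (coface ord0)))
  - x (existT _ (projT1 nf) (sx_comp (cone (projT2 nf)) (coface (lift ord0 ord0))))
  + x (existT _ (projT1 nf) (vertex ord0))).
by rewrite cone_coface0 cone_coface1 subrK; case: nf.
Qed.

Lemma delta_const0 q (x : G 0 q) : delta G 0 q (const0 q x) = 0.
Proof. by rewrite delta0E; exact: subrr. Qed.

Lemma const0_id q (x : G 0 q) : delta G 0 q x = 0 -> const0 q x = x.
Proof. by move=> dx; have := sigma_delta0 x; rewrite dx linear0 add0r. Qed.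

Lemma sigma_normalized p q (x : G p.+1 q) :
  normalized G p.+1 q x -> normalized G p q (sigma p q x).
Proof.
case: p x => [//|p] x Nx i; apply: dprod_ext => nf.
rewrite -[LHS]/(x (existT _ (projT1 nf) (cone (sx_comp (projT2 nf) (codegen i))))).
rewrite -cone_codegen.
exact: (congr1 (fun z : G p.+1 q => z (under_cone nf)) (Nx (lift ord0 i))).
Qed.

End CofreeContraction.

(** * The rows of the resolution *)

Section RowSolution.
Variables (R : realType) (C : cosimplicial R).
Local Notation Y := (reso C).

Lemma del_delta s p q (x : Y s p q) :
  del C s p.+1 q (delta (Y s) p q x) = delta (Y s.+1) p q (del C s p q x).
Proof.
rewrite -[delta (Y s) _ _ _]/(delta_fun x) -[RHS]/(delta_fun (del C s p q x)).
by rewrite /delta_fun linear_sum; apply: eq_bigr => i _; rewrite linearZ_LR del_act.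
Qed.

Variables (eps : R) (y : forall p, slots C p).
Arguments y : clear implicits.
Hypothesis eps2 : eps * eps = 1.
(** The family [y] stands for the columns of an element whose total differential vanishes in
    positive columns; in column 0 that differential need only lie in the limit. *)
Hypothesis y_row : forall p s t,
  D_slots C p.+1 (y p.+1) (s, t) = eps *: delta (Y s.+1) p t (y p (s, t)).
Hypothesis y_row0 : forall s t, delta (Y s.+1) 0 t (D_slots C 0 (y 0) (s, t)) = 0.

(* A primitive for y, up to [const_slots], with respect to the total differential;
   sigma inverts delta on each row, and the rows are treated in the order of s.
   The sign [eps] stands for (-1)^k, with k the total degree of y. *)
Fixpoint prim s p t : Y s.+1 p t :=
  match s return Y s.+1 p t with
  | 0 => eps *: sigma C p t (y p.+1 (0, t)%N)
  | s'.+1 => eps *: sigma (Y s'.+1) p t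
      (y p.+1 (s'.+1, t) - del C s'.+1 p.+1 t (@prim s' p.+1 t))
  end.

Definition prim_slots p : slots C p := fun st => @prim st.1 p st.2.

Arguments prim_slots : clear implicits.

(** What remains of row [s] once row [s - 1] of the primitive has contributed through [del]; it is
    to be solved inside row [s] alone. *)
Definition residue p : slots C p := fun st => y p st - shift (prim_slots p) st.1 st.2.

Arguments residue : clear implicits.

Definition const_slots : slots C 0 := fun st =>
  const0 (Y st.1) st.2 (residue 0 st).

Lemma primE p s t :
  prim_slots p (s, t) = eps *: sigma (Y s) p t (residue p.+1 (s, t)).
Proof. by case: s => [|s] //; rewrite /residue [shift _ _ _]/(0 : Y 1 _ _) subr0. Qed.

(** The residues satisfy the relations imposed on [y], with only the internal part of the
    differential. *)
Let row s :=
  (forall p t, delta (Y s.+1) p t (residue p (s, t)) =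
     eps *: ((-1) ^+ s *: ch_d (Y s.+1 p.+1) t (residue p.+1 (s, t.+1)))) /\
  (forall t, delta (Y s.+1) 0 t ((-1) ^+ s *: ch_d (Y s.+1 0) t (residue 0 (s, t.+1))) = 0).

Let solved s :=
  (forall t, y 0 (s, t) = const_slots (s, t) + D_slots C 0 (prim_slots 0) (s, t)) /\
  (forall p t, y p.+1 (s, t) = D_slots C p.+1 (prim_slots p.+1) (s, t)
     + eps *: delta (Y s.+1) p t (prim_slots p (s, t))).

Lemma y_residue p s t : y p (s, t) = residue p (s, t) + shift (prim_slots p) s t.
Proof. by rewrite /residue /= subrK. Qed.

Lemma sigma_scale_d s p t (a b : R) (x : Y s.+1 p.+1 t.+1) :
  a *: ch_d (Y s.+1 p) t (b *: sigma (Y s) p t.+1 x) =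
  sigma (Y s) p t (b *: (a *: ch_d (Y s.+1 p.+1) t x)).
Proof.
have -> : ch_d (Y s.+1 p) t (b *: sigma (Y s) p t.+1 x) =
    b *: sigma (Y s) p t (ch_d (Y s.+1 p.+1) t x).
  exact: (linearZ_LR (ch_d (Y s.+1 p) t)).
rewrite (linearZ_LR (sigma (Y s) p t)) (linearZ_LR (sigma (Y s) p t)).
by rewrite !scalerA mulrC.
Qed.

(** As [sigma] commutes with the internal differential, [row] turns the differential of the
    primitive into [sigma (delta residue)]; the contraction identity then recovers the residue, with
    [const0] accounting for column 0. *)
Lemma solved_row s : row s -> solved s.
Proof.
move=> [rS r0].
have dE p t : (-1) ^+ s *: ch_d (Y s.+1 p) t (prim_slots p (s, t.+1)) =
    sigma (Y s) p t (delta (Y s.+1) p t (residue p (s, t))).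
  by rewrite primE rS; exact: sigma_scale_d.
split=> [t|p t]; rewrite y_residue D_slotsE dE.
  rewrite addrA; congr (_ + _).
  by have := sigma_delta0 (residue 0 (s, t)); rewrite addrC => ->.
rewrite [RHS]addrAC; congr (_ + _); rewrite primE.
rewrite (linearZ_LR (delta (Y s.+1) p t)) scalerA eps2 scale1r.
exact/esym/sigma_delta.
Qed.

Lemma del_D_slots p (x : slots C p) s t : del C s.+1 p t (D_slots C p x (s, t)) =
  (-1) ^+ s *: ch_d (Y s.+2 p) t (del C s.+1 p t.+1 (x (s, t.+1))).
Proof.
rewrite D_slotsE (linearD (del C s.+1 p t)) del_shift addr0.
by rewrite (linearZ_LR (del C s.+1 p t)) del_d.
Qed.

Lemma residueSE p s t : residue p (s.+1, t) =
  y p (s.+1, t) - del C s.+1 p t (prim_slots p (s, t)).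
Proof. by []. Qed.

Lemma row_d p s t : (-1) ^+ s.+1 *: ch_d (Y s.+2 p) t (residue p (s.+1, t.+1)) =
  D_slots C p (y p) (s.+1, t) - del C s.+1 p t (y p (s, t) - D_slots C p (prim_slots p) (s, t)).
Proof.
rewrite residueSE (linearB (ch_d (Y s.+2 p) t)) D_slotsE.
rewrite -[shift _ _ _]/(del C s.+1 p t (y p (s, t))).
rewrite (linearB (del C s.+1 p t)) del_D_slots opprB addrA [X in _ = X - _]addrAC addrK.
rewrite scalerBr; congr (_ + _).
by rewrite exprS mulN1r scaleNr opprK.
Qed.

(** By [row_d] the differential of the next residue involves [del] of the error [y - D_slots prim]
    in row [s]. That error is a [delta] of the primitive in positive columns and a constant in
    column 0, so [delta] controls it. *)
Lemma row_step s : solved s -> row s.+1.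
Proof.
move=> [s0 sS]; split=> [p t|t].
  rewrite row_d y_row sS addrAC subrr add0r residueSE (linearB (delta (Y s.+2) p t)).
  rewrite scalerBr scalerA eps2 scale1r; congr (_ - _).
  by rewrite (linearZ_LR (del C s.+1 p.+1 t)) scalerA eps2 scale1r del_delta.
rewrite row_d s0 addrK (linearB (delta (Y s.+2) 0 t)) y_row0 -del_delta.
by rewrite delta_const0 linear0 subr0.
Qed.

Lemma all_rows s : row s.
Proof.
have r0 p t : D_slots C p (y p) (0, t)%N = ch_d (Y 1 p) t (residue p (0, t.+1)%N).
  by rewrite D_slotsE expr0 scale1r addr0 /residue [shift (prim_slots _) _ _]/(0 : Y 1 _ _) subr0.
elim: s => [|s IHs]; last exact/row_step/solved_row.
split=> [p t|t]; rewrite expr0 scale1r -r0; last exact: y_row0.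
rewrite y_row scalerA eps2 scale1r.
by rewrite /residue [shift (prim_slots _) _ _]/(0 : Y 1 _ _) subr0.
Qed.

Lemma residue_d s t : (-1) ^+ s *: ch_d (Y s.+1 0) t (const_slots (s, t.+1)) =
  (-1) ^+ s *: ch_d (Y s.+1 0) t (residue 0 (s, t.+1)).
Proof.
rewrite -[RHS](const0_id ((all_rows s).2 t)).
exact/esym/(linearZ_LR (const0 (Y s) t)).
Qed.

(** The internal differential of the residue in column 0 already lies in the limit, so [const0]
    leaves it unchanged. This gives the truncation condition for the constant part. *)
Lemma const_slots_d : D_slots C 0 const_slots = D_slots C 0 (y 0).
Proof.
apply: dprod_ext => -[s t]; rewrite [LHS]D_slotsE residue_d.
case: s => [|s].
  rewrite addr0 D_slotsE addr0 /residue [shift (prim_slots _) _ _]/(0 : Y 1 _ _).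
  by rewrite subr0.
have [s0 _] := solved_row (all_rows s).
by rewrite row_d s0 addrK -[shift _ _ _]/(del C s.+1 0 t (const_slots (s, t))) subrK.
Qed.

Lemma const_slots_delta s t : delta (Y s.+1) 0 t (const_slots (s, t)) = 0.
Proof. exact: delta_const0. Qed.

Lemma y0_solution : y 0 = const_slots + D_slots C 0 (prim_slots 0).
Proof. by apply: dprod_ext => -[s t]; exact: (solved_row (all_rows s)).1. Qed.

Lemma yS_solution p s t : y p.+1 (s, t) = D_slots C p.+1 (prim_slots p.+1) (s, t)
     + eps *: delta (Y s.+1) p t (prim_slots p (s, t)).
Proof. exact: (solved_row (all_rows s)).2. Qed.

Lemma prim_supp k : (forall p s t, t != (p + k + s)%N -> y p (s, t) = 0) ->
  forall p s t, t != ((p + k).+1 + s)%N -> prim_slots p (s, t) = 0.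
Proof.
move=> ys p s; elim: s p => [|s IHs] p t ts; rewrite primE.
  rewrite /residue [shift _ _ _]/(0 : Y 1 _ _) subr0 ys; last by lia.
  by rewrite [sigma _ _ _ _]linear0 scaler0.
rewrite residueSE ys ?IHs; try by lia.
by rewrite (linear0 (del C s.+1 p.+1 t)) subr0 [sigma _ _ _ _]linear0 scaler0.
Qed.

Lemma const_supp k : (forall p s t, t != (p + k + s)%N -> y p (s, t) = 0) ->
  forall s t, t != (k + s)%N -> const_slots (s, t) = 0.
Proof.
move=> ys s t ts; rewrite -[LHS]/(const0 (Y s) t (residue 0 (s, t))).
case: s ts => [|s] ts.
  by rewrite /residue [shift _ _ _]/(0 : Y 1 _ _) subr0 ys ?linear0.
rewrite residueSE ys // (prim_supp ys); last by lia.
by rewrite (linear0 (del C s.+1 0 t)) subr0 linear0.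
Qed.

Lemma normalized_del s p q x : normalized (Y s) p q x -> normalized (Y s.+1) p q (del C s p q x).
Proof. by case: p x => [//|p] x Nx i; rewrite -del_act Nx linear0. Qed.

Lemma prim_normalized : (forall p s t, normalized (Y s.+1) p t (y p (s, t))) ->
  forall p s t, normalized (Y s.+1) p t (prim_slots p (s, t)).
Proof.
move=> yN p s; elim: s p => [|s IHs] p t; rewrite primE;
    apply: submodZ; apply: sigma_normalized.
  rewrite /residue [shift _ _ _]/(0 : Y 1 _ _) subr0; exact: (yN p.+1 0%N t).
rewrite residueSE; apply: (submodB (S := normalized (Y s.+2) p.+1 t)).
  exact: (yN p.+1 s.+1 t).
exact: (normalized_del (IHs p.+1 t)).
Qed.

End RowSolution.

Arguments prim_slots {R C} eps y p.

(** * From the limit to the total complex *)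

Section ColumnZero.
Variables (R : realType) (F : cosimplicial R).

Definition normalized0 q (z : F 0 q) : Ncx F 0 q :=
  mksub (S := normalized F 0 q) (x := z) I.

Definition column0_fun q (z : F 0 q) : bigraded F :=
  single (V := fun pq => Ncx F pq.1 pq.2) (i := (0, q)%N) (normalized0 z).

Lemma column0_linear q : linear (@column0_fun q).
Proof.
move=> a x y; rewrite /column0_fun -single_linear; congr (single _).
exact/val_inj.
Qed.

Definition column0 q : {linear F 0 q -> bigraded F} := linear_pack (@column0_linear q).

Lemma column0_same q z : column0 q z (0, q)%N = normalized0 z.
Proof. exact: (single_same (V := fun pq => Ncx F pq.1 pq.2) (i := (0, q)%N)). Qed.

Lemma column0_other q z pq : pq != (0, q)%N -> column0 q z pq = 0.
Proof. exact: (single_other (V := fun pq => Ncx F pq.1 pq.2)). Qed.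

Lemma column0_otherS q z p q' : column0 q z (p.+1, q') = 0.
Proof. exact: column0_other. Qed.

Lemma column0_line (q : nat) z : line F q (column0 q z).
Proof. by move=> p q' pq; apply: column0_other; rewrite xpair_eqE; lia. Qed.

Lemma Ndelta_column0 q z q' : delta F 0 q z = 0 -> Ndelta F 0 q' (column0 q z (0, q')%N) = 0.
Proof.
move=> dz; have [->|qq] := eqVneq q' q; last by rewrite column0_other ?linear0 // xpair_eqE.
by rewrite column0_same; exact/val_inj.
Qed.

Lemma D_column0 q z : delta F 0 q.+1 z = 0 -> D F (column0 q.+1 z) = column0 q (ch_d (F 0) q z).
Proof.
move=> dz; apply: dprod_ext => -[[|p] q'].
  rewrite D0E; have [->|qq] := eqVneq q' q; first by rewrite !column0_same; exact/val_inj.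
  by rewrite !column0_other ?linear0 // xpair_eqE.
rewrite DSE !column0_otherS linear0 sub0r; case: p => [|p].
  by rewrite Ndelta_column0 // scaler0 oppr0.
by rewrite column0_otherS linear0 scaler0 oppr0.
Qed.

Lemma D_column00 z : delta F 0 0 z = 0 -> D F (column0 0 z) = 0.
Proof.
move=> dz; apply: dprod_ext => -[[|p] q'].
  by rewrite D0E column0_other // linear0.
rewrite DSE !column0_otherS linear0 sub0r; case: p => [|p].
  by rewrite Ndelta_column0 // scaler0 oppr0.
by rewrite column0_otherS linear0 scaler0 oppr0.
Qed.

End ColumnZero.

Lemma bigraded_map_column0 (R : realType) (A B : cosimplicial R) (f : cosimplicial_map A B)
  q (z : A 0 q) : bigraded_map f (column0 A q z) = column0 B q (f 0 q z).
Proof.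
apply: dprod_ext => -[p q']; rewrite bigraded_mapE.
have [[-> ->]|N] := eqVneq (p, q') (0, q)%N; first by rewrite !column0_same; exact/val_inj.
by rewrite !column0_other // linear0.
Qed.

(** * The total complex of the fibrant replacement *)

Section FibrepRows.
Variables (R : realType) (C : cosimplicial R).
Local Notation Y := (reso C).

Lemma fibrep_slot_linear p q s t : linear (fun x : fibrep C p q => \val x (s, t) : Y s.+1 p t).
Proof. by []. Qed.

Lemma fibrep_delta p q (x : fibrep C p q) s t :
  \val (delta (fibrep C) p q x) (s, t) = delta (Y s.+1) p t (\val x (s, t)).
Proof.
rewrite -[LHS]/(linear_pack (@fibrep_slot_linear p.+1 q s t) (delta_fun x)).
rewrite -[RHS]/(delta_fun (\val x (s, t))) /delta_fun linear_sum.
by apply: eq_bigr => i _; rewrite linearZ_LR.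
Qed.

Lemma fibrep_normalized p q (x : fibrep C p q) : normalized (fibrep C) p q x <->
  forall s t, normalized (Y s.+1) p t (\val x (s, t)).
Proof.
case: p x => [//|p] x; split=> [Nx s t i|Nx i].
  exact: (congr1 (fun z : fibrep C p q => \val z (s, t)) (Nx i)).
by apply/val_inj/dprod_ext => -[s t]; exact: (Nx s t i).
Qed.

Variables (k : nat) (y : bigraded (fibrep C)).
Hypothesis y_line : line (fibrep C) k y.
Hypothesis DyS : forall p q, D (fibrep C) y (p.+1, q) = 0.
Hypothesis Dy0 : forall q, Ndelta (fibrep C) 0 q (D (fibrep C) y (0, q)%N) = 0.

(** On the line [q - p = k], the entry at [q = p + k] is the only one of column [p] that can be
    nonzero. *)
Definition diag p : slots C p := \val (\val (y (p, p + k)%N)).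
Arguments diag : clear implicits.

Lemma diag_fibrep p : fibrep_sub C p (p + k) (diag p).
Proof. exact: (subsp_mem (\val (y (p, p + k)%N))). Qed.

Lemma diag_row p s t : D_slots C p.+1 (diag p.+1) (s, t) =
  (-1) ^+ k *: delta (Y s.+1) p t (diag p (s, t)).
Proof.
have := DyS p (p + k); rewrite DSE => /eqP; rewrite subr_eq0.
have -> : (p + k)%:Z - p%:Z = k by lia.
move=> /eqP/(congr1 (fun z : Ncx (fibrep C) p.+1 (p + k) => \val (\val z) (s, t))).
rewrite -[X in X = _ -> _]/(D_slots C p.+1 (diag p.+1) (s, t)) => ->.
by rewrite -fibrep_delta.
Qed.

Lemma diag_row0 s t : delta (Y s.+1) 0 t (D_slots C 0 (diag 0) (s, t)) = 0.
Proof.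
(* In degree 0 the entry is a cycle by the smart truncation; in positive degree [Dy0] applies. *)
rewrite /diag; move: (0 + k)%N => [|n].
  by rewrite (subsp_mem (\val (y (0, 0)%N))).2 //; exact: linear0.
have /(congr1 (fun z : Ncx (fibrep C) 1 n => \val (\val z) (s, t))) := Dy0 n.
by rewrite -[X in X = _ -> _]/(\val (delta (fibrep C) 0 n _) (s, t)) fibrep_delta.
Qed.

Lemma sign_sqr : (-1) ^+ k * (-1) ^+ k = 1 :> R.
Proof. by rewrite -exprD addnn -mul2n exprM sqrrN expr1n expr1n. Qed.

Local Notation prim := (prim_slots ((-1) ^+ k) diag).
Local Notation const := (const_slots ((-1) ^+ k) diag).

Lemma diag_supp p s t : t != (p + k + s)%N -> diag p (s, t) = 0.
Proof. exact: (diag_fibrep p).1. Qed.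

Lemma diag_normalized p s t : normalized (Y s.+1) p t (diag p (s, t)).
Proof. exact: ((fibrep_normalized _).1 (subsp_mem (y (p, p + k)%N))). Qed.

Lemma const_fibrep : fibrep_sub C 0 k const.
Proof.
split=> [s t ts|k0].
  exact: (const_supp _ diag_supp ts).
rewrite (const_slots_d sign_sqr diag_row diag_row0).
by apply: (diag_fibrep 0).2; rewrite k0.
Qed.

(** Testing the degree, with 0 as default, gives an entry for every [q] without transport along
    [q = (p + k).+1]. *)
Definition prim_at p q : slots C p := if q == (p + k).+1 then prim p else 0.
Arguments prim_at : clear implicits.

Lemma prim_fibrep p q : fibrep_sub C p q (prim_at p q).
Proof.
rewrite /prim_at; case: eqP => [->|_]; last exact: smem0.
by split=> // s t ts; exact: (prim_supp _ diag_supp ts).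
Qed.

Lemma prim_N p q : normalized (fibrep C) p q (mksub (prim_fibrep p q)).
Proof.
apply/fibrep_normalized => s t; rewrite -[\val _]/(prim_at p q) /prim_at; case: eqP => _.
  exact: (prim_normalized _ diag_normalized).
exact: (smem0 (normalized (Y s.+1) p t)).
Qed.

Definition prim_bigraded : bigraded (fibrep C) := fun pq => mksub (prim_N pq.1 pq.2).

Lemma prim_line : line (fibrep C) k.+1 prim_bigraded.
Proof.
move=> p q pq; apply/val_inj/val_inj; rewrite /= /prim_at.
by move: pq; case: (q =P _) => // -> /eqP pq; case: pq; lia.
Qed.

(** The row solution read in bigraded form: the constant part is [z] and the primitive is [y']. A
    nonzero [D] in column 0 is allowed because relative lifting prescribes it there. *)
Lemma fibrep_row_lift : exists (z : fibrep C 0 k) (y' : bigraded (fibrep C)),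
  [/\ delta (fibrep C) 0 k z = 0,
      line (fibrep C) k.+1 y' & y = column0 (fibrep C) k z + D (fibrep C) y'].
Proof.
exists (mksub const_fibrep), prim_bigraded; split; last 1 first.
- apply: dprod_ext => -[p q].
  rewrite -[RHS]/(column0 _ _ _ (p, q) + D (fibrep C) prim_bigraded (p, q)).
  have [qE|qN] := eqVneq q (p + k)%N; last first.
    rewrite y_line; last by lia.
    rewrite column0_line; last by lia.
    rewrite add0r (line_D prim_line) //; by lia.
  subst q; case: p => [|p].
    rewrite column0_same; apply/val_inj/val_inj.
    rewrite -[RHS]/(const + D_slots C 0 (prim_at 0 k.+1)) /prim_at eqxx.
    by rewrite -(y0_solution sign_sqr diag_row diag_row0).
  rewrite column0_otherS add0r DSE; apply/val_inj/val_inj/dprod_ext => -[s t].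
  have -> : (p.+1 + k)%:Z - p%:Z = k.+1 by lia.
  rewrite -[LHS]/(diag p.+1 (s, t)).
  rewrite -[RHS]/(D_slots C p.+1 (prim_at p.+1 (p.+1 + k).+1) (s, t) - (-1) ^+ k.+1 *:
    \val (delta (fibrep C) p (p + k).+1 (mksub (prim_fibrep p (p + k).+1))) (s, t)).
  rewrite fibrep_delta -[\val _]/(prim_at p (p + k).+1) /prim_at !eqxx.
  rewrite exprS mulN1r scaleNr opprK.
  exact: (yS_solution sign_sqr diag_row diag_row0).
- by apply/val_inj/dprod_ext => -[s t]; rewrite fibrep_delta; exact: const_slots_delta.
- exact: prim_line.
Qed.

End FibrepRows.

Section LimitToTot.
Variables (R : realType) (F : cosimplicial R).

Definition id_cosimplicial_map : cosimplicial_map F F :=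
  @CosimplicialMap R F F
    (fun n => @ChainMap R (F n) (F n) (fun q => idfun) (fun q x => erefl))
    (fun m n f q x => erefl).

Variables (L : chain R) (pr : forall n, chain_map L (F n)).
Hypotheses (F_fib : injectively_fibrant F) (prL : is_limit pr).

Definition limit_phi k : {linear L k -> bigraded F} := column0 F k \o pr 0 k.

Lemma limit_phi_line (k : nat) x : line F k (limit_phi k x).
Proof. exact: column0_line. Qed.

Lemma limit_phi_d k x : limit_phi k (ch_d L k x) = D F (limit_phi k.+1 x).
Proof.
rewrite -[RHS]/(D F (column0 F k.+1 (pr 0 k.+1 x))) D_column0 -?cm_d //.
exact: cone_delta prL.1.
Qed.

Lemma limit_phi_d0 x : D F (limit_phi 0 x) = 0.
Proof. by apply: D_column00; exact: cone_delta prL.1. Qed.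

Definition limit_to_tot : chain_map L (tot F) :=
  to_tot limit_phi_line limit_phi_d limit_phi_d0.

Lemma tot_val_limit k x : tot_val (limit_to_tot k x) = column0 F k (pr 0 k x).
Proof. exact: tot_val_to_tot. Qed.

(* F is a retract of fibrep F, because F -> fibrep F is a trivial cofibration. *)
Lemma limit_to_tot_qi : quasi_iso limit_to_tot.
Proof.
have pr_delta q x : delta F 0 q (pr 0 q x) = 0 by exact: cone_delta prL.1.
have [r rE] := F_fib (@fibrep_unit_mono R F) (@fibrep_unit_qi R F) id_cosimplicial_map.
set j := fibrep_unit F in rE.
have rj (x : bigraded F) : bigraded_map r (bigraded_map j x) = x.
  by apply: dprod_ext => -[p q]; rewrite !bigraded_mapE; apply/val_inj; exact: rE.
(* Move to [fibrep F] along [j], decompose there, and come back along [r], which preserves both the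
   limit part and the boundary part. *)
have lift (k : nat) (x : bigraded F) : line F k x ->
    (forall p q, D F x (p.+1, q) = 0) -> (forall q, Ndelta F 0 q (D F x (0, q)%N) = 0) ->
    exists (l : L k) (v : tot F k.+1), x = column0 F k (pr 0 k l) + D F (tot_val v).
  move=> lx DS D0.
  have [|p q|q|z [y' [dz ly' yE]]] := @fibrep_row_lift R F k (bigraded_map j x).
  - exact: bigraded_map_line.
  - by rewrite -bigraded_map_D bigraded_mapE DS linear0.
  - by rewrite -bigraded_map_D bigraded_mapE -Nmap_Ndelta D0 linear0.
  have [|l lE] := limit_surj prL (z := r 0 k z).
    by rewrite -cosimplicial_map_delta dz linear0.
  have [||v vE] := @tot_val_surj R F k.+1 (bigraded_map r y') => //.
    exact: bigraded_map_line.
  by exists l, v; rewrite vE lE -bigraded_map_column0 -bigraded_map_D -linearD -yE rj.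
have lin k (u v : tot F k) : tot_val (u + v) = tot_val u + tot_val v.
  exact: (linearD (linear_pack (@tot_val_linear R F k))).
apply/quasi_isoP => -[b|q a b ca db].
  have Db : D F (tot_val b) = 0 by exact: tot_val_cycle.
  have [p q|q|l [v xE]] := lift 0%N _ (tot_val_line b).
  - by rewrite Db.
  - by rewrite Db; exact: linear0.
  by exists l, v; apply: tot_val_inj; rewrite lin tot_val_limit tot_val_d.
have Db : D F (tot_val b) = column0 F q (pr 0 q a) by rewrite -tot_val_d db tot_val_limit.
have [p q'|q'|l [v xE]] := lift q.+1 _ (tot_val_line b).
- by rewrite Db column0_otherS.
- by rewrite Db Ndelta_column0.
exists l, v; split; last first.
  by apply: tot_val_inj; rewrite lin tot_val_limit tot_val_d.
(* Applying [D] to the decomposition of [b] leaves only the limit part; its entry in column 0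
   identifies the differential of [l] with [a]. *)
apply: (limit_inj prL); move: Db.
rewrite xE linearD D_D addr0 D_column0 // -cm_d.
move=> /(congr1 (fun z : bigraded F => z (0, q)%N)).
by rewrite !column0_same => /(congr1 val).
Qed.

End LimitToTot.

Theorem propositionB4 (R : realType) (C : cosimplicial R) :
  (exists L : chain R, is_holim C L) /\
  (forall L : chain R, is_holim C L -> weakly_equivalent L (tot C)).
Proof.
split=> [|L [F [j [pr [j_qi F_fib prL]]]]].
  exists (limit_chain (fibrep C)), (fibrep C), (fibrep_unit C), (limit_pr (fibrep C)).
  by split; [exact: fibrep_unit_qi|exact: fibrep_fibrant|exact: limit_is_limit].
apply: (rst_trans _ _ _ (tot F)).
  by apply: rst_step; exists (limit_to_tot prL); exact: limit_to_tot_qi.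
apply: rst_sym; apply: rst_step; exists (tot_map j); exact: tot_map_qi.
Qed.
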